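(* Let $k \geq 2$ be an integer and let $\lambda \asymp 1$ as $d \to \infty$. Let $\hat{\boldsymbol V} \in (\mathbb{R}^d)^{\otimes k}$ denote any estimator for $k$-ATPCA with signal-to-noise ratio $\lambda$ that can be computed using a memory bounded estimation algorithm with resource profile $(N, T, s)$ scaling with $d$ as $$N \asymp d^{\eta}/\lambda^2, \quad T \asymp d^{\tau}, \quad s \asymp d^{b}$$ for any constants $\eta > 0$, $\tau \geq 0$, $b \geq 0$. If $$\eta + \tau + b < k,$$ then, for any $t \in \mathbb{R}$, $$\limsup_{d \to \infty}\ \inf_{\boldsymbol V \in \mathcal{V}} \mathbb{P}_{\boldsymbol V}\left( \frac{|\langle \boldsymbol V, \hat{\boldsymbol V}\rangle|^2}{\|\boldsymbol V\|^2 \|\hat{\boldsymbol V}\|^2} \geq \frac{t^2}{d^k} \right) \leq \frac{1}{t^2}.$$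
   Context: **Asymmetric order-$k$ Tensor PCA ($k$-ATPCA).** The parameter space is $\mathcal{V} = \{\boldsymbol V_1 \otimes \boldsymbol V_2 \otimes \dots \otimes \boldsymbol V_k : \boldsymbol V_i \in \mathbb{R}^d,\ \|\boldsymbol V_i\| = \sqrt{d}\ \forall i \in [k]\}$. Given $\boldsymbol V = \boldsymbol V_1 \otimes \dots \otimes \boldsymbol V_k \in \mathcal{V}$ one observes $N$ i.i.d. tensors $\boldsymbol X_1,\dots,\boldsymbol X_N \in (\mathbb{R}^d)^{\otimes k}$ with $$\boldsymbol X_i = \frac{\lambda\, \boldsymbol V_1 \otimes \boldsymbol V_2 \otimes \dots \otimes \boldsymbol V_k}{\sqrt{d^k}} + \boldsymbol W_i, \qquad (W_i)_{j_1,\dots,j_k} \overset{\text{i.i.d.}}{\sim} \mathcal{N}(0,1)\ \ \forall j_1,\dots,j_k \in [d],$$ where $\lambda>0$ is the signal-to-noise ratio. $\mathbb{P}_{\boldsymbol V}$ denotes probability when the data are generated with parameter $\boldsymbol V$. Inner products and norms of tensors are the Euclidean ones (tensors viewed as vectors of their entries). **Memory bounded estimation algorithm with resource profile $(N,T,s)$.** Such an algorithm makes $T$ passes over a dataset of $N$ samples $\boldsymbol x_1, \dots, \boldsymbol x_N \in \mathcal{X}$ (here $\boldsymbol x_i=\boldsymbol X_i$) using a memory state of $s$ bits, initially all zeros. It is specified by arbitrary update functions $f_{t,i} : \{0,1\}^s \times \mathcal{X} \to \{0,1\}^s$ ($t \in [T]$, $i \in [N]$) and an arbitrary estimator function $g$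 on $\{0,1\}^s$. For $t = 1,\dots,T$ in order, and within each pass for $i = 1,\dots,N$ in order, the state is updated by $\mathtt{state} \leftarrow f_{t,i}(\mathtt{state}, \boldsymbol x_i)$. After all $T$ passes the output is $\hat{\boldsymbol V} = g(\mathtt{state})$. **Asymptotic notation.** For non-negative sequences indexed by $d$, $a_d \lesssim b_d$ means $\limsup_{d\to\infty} a_d/b_d < \infty$; $a_d \asymp b_d$ means $a_d \lesssim b_d$ and $b_d \lesssim a_d$. $k$ is fixed as $d \to \infty$. *)

(* Defs.v *)
(* MathComp / MathComp-Analysis, over an abstract R : realType. *)
From HB Require Import structures.
From mathcomp Require Import all_boot all_order all_algebra.
From mathcomp Require Import all_classical all_reals all_analysis.

Set Implicit Arguments.
Unset Strict Implicit.
Unset Printing Implicit Defensive.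
Import Order.TTheory GRing.Theory Num.Theory.
Import numFieldNormedType.Exports.

Local Open Scope classical_set_scope.
Local Open Scope ring_scope.

(* The quotient is taken in the extended reals, where c / 0 = +oo for c > 0:
   with the total division of R, zeros of b would be silently ignored. *)
Definition asymp_le (R : realType) (a b : nat -> R) : Prop :=
  (limn_esup (fun d => (a d)%:E / (b d)%:E) < +oo)%E.

Definition asymp_eq (R : realType) (a b : nat -> R) : Prop :=
  asymp_le a b /\ asymp_le b a.

(* The Euclidean structure is spelled out because `|x| on the library's
   matrices and function spaces is the sup norm. *)
Definition inner (R : realType) (I : finType) (u v : {ffun I -> R}) : R :=
  \sum_i u i * v i.

Definition enorm (R : realType) (I : finType) (u : {ffun I -> R}) : R :=
  Num.sqrt (inner u u).

(* A multi-index (j_1, ..., j_k) in [d]^k is a map from positions to 'I_d. *)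
Definition mindex (k d : nat) : finType := {ffun 'I_k -> 'I_d}.

Definition tensor (R : realType) (k d : nat) : Type := {ffun mindex k d -> R}.

Definition tensor_prod (R : realType) (k d : nat) (v : 'I_k -> {ffun 'I_d -> R})
  : tensor R k d := [ffun j : mindex k d => \prod_(i < k) v i (j i)].

Definition ATPCA_param (R : realType) (k d : nat) : set (tensor R k d) :=
  [set V | exists2 v : 'I_k -> {ffun 'I_d -> R},
     (forall i, enorm (v i) = Num.sqrt d%:R) & V = tensor_prod v].

(* Tensors carry the Borel sigma-algebra, i.e. the one generated by the
   entries. *)
Definition tensor_cylinders (R : realType) (k d : nat) : set_system (tensor R k d) :=
  [set A | exists (j : mindex k d) (B : set R),
     measurable B /\ A = [set X : tensor R k d | B (X j)]].

Section tensor_measurable.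
Variables (R : realType) (k d : nat).

HB.instance Definition _ := Choice.on (tensor R k d).
HB.instance Definition _ :=
  isPointed.Build (tensor R k d) ([ffun=> 0] : {ffun mindex k d -> R}).
HB.instance Definition _ := @isMeasurable.Build
  (sigma_display (@tensor_cylinders R k d)) (tensor R k d) <<s @tensor_cylinders R k d >>
  (@sigma_algebra0 _ setT _) (@sigma_algebraC _ _) (@sigma_algebra_bigcup _ setT _).

End tensor_measurable.

(* The update functions are arbitrary up to the measurability that makes the
   law of the output well defined; memory_update t i m x is f_{t,i}(m, x). *)
Record memory_algorithm (disp : measure_display) (X : measurableType disp)
    (Y : Type) (N T s : nat) := MemoryAlgorithm {
  memory_update : 'I_T -> 'I_N -> s.-tuple bool -> X -> s.-tuple bool ;
  memory_update_measurable : forall t i m,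
    measurable_fun [set: X] (memory_update t i m) ;
  memory_estimator : s.-tuple bool -> Y }.

(* enum 'I_n lists 0, ..., n.-1 in increasing order. *)
Definition memory_output (disp : measure_display) (X : measurableType disp)
    (Y : Type) (N T s : nat) (A : memory_algorithm X Y N T s) (x : 'I_N -> X) : Y :=
  let pass m t := foldl (fun m' i => memory_update A t i m' (x i)) m (enum 'I_N) in
  memory_estimator A (foldl pass [tuple of nseq s false] (enum 'I_T)).

Definition mutually_independent (disp : measure_display)
    (Omega : measurableType disp) (R : realType) (P : probability Omega R)
    (I : finType) (Z : I -> {RV P >-> R}) : Prop :=
  forall (J : {set I}) (B : I -> set R), (forall i, measurable (B i)) ->
    P [set w | forall i, i \in J -> B i (Z i w)]
    = (\prod_(i in J) P (Z i @^-1` B i))%E.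

Definition iid_standard_normal (disp : measure_display)
    (Omega : measurableType disp) (R : realType) (P : probability Omega R)
    (I : finType) (Z : I -> {RV P >-> R}) : Prop :=
  mutually_independent Z /\
  forall i (B : set R), measurable B -> P (Z i @^-1` B) = normal_prob 0 1 B.

(* W (i, j) is the noise in entry j of sample i. *)
Definition ATPCA_data (disp : measure_display) (Omega : measurableType disp)
    (R : realType) (P : probability Omega R) (k d N : nat) (lambda : R)
    (W : 'I_N * mindex k d -> {RV P >-> R}) (V : tensor R k d) (w : Omega)
    (i : 'I_N) : tensor R k d :=
  [ffun j : mindex k d => lambda * V j / Num.sqrt (d%:R ^+ k) + W (i, j) w].

(* This is 0 when Vhat = 0, since division by zero gives 0. *)
Definition sq_cosine (R : realType) (k d : nat) (V Vhat : tensor R k d) : R :=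
  `|inner V Vhat| ^+ 2 / (enorm V ^+ 2 * enorm Vhat ^+ 2).

(* Main.v *)
Require Import Defs.
From HB Require Import structures.
From mathcomp Require Import all_boot all_order all_algebra.
From mathcomp Require Import all_classical all_reals all_analysis.
From mathcomp Require Import measurable_realfun.
From mathcomp Require Import ring lra.

Set Implicit Arguments.
Unset Strict Implicit.
Unset Printing Implicit Defensive.
Import Order.TTheory GRing.Theory Num.Theory.
Import numFieldNormedType.Exports.
Local Open Scope classical_set_scope.
Local Open Scope ring_scope.

(** An infimum over the parameter space is at most an average over any prior.
Write D = d ^ k and take the uniform prior on the D parameters sqrt D e_j,
where e_j is the j-th basis tensor ([spike]).  They are isotropic: the squared
cosines of a fixed tensor u with them are u_j ^ 2 / ||u|| ^ 2 and sum to at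
most 1, so by Markov's inequality at most D / t ^ 2 of them have squared cosine
at least t ^ 2 / D with u ([card_large_cosine]).  An output that is independent
of j is therefore good with probability at most 1 / t ^ 2, and it remains to
show that, for most j, the memory cannot distinguish the samples lambda e_j + W_i
from the pure noise W_i.

Samples as finite data.  A sample acts on the algorithm only through the
function (pass, state) |-> new state, an element of a finite type ([response]).
The sequence of all memory states is a transcript; the responses that produce a
given transcript form a product set, one factor, called a cell, per sample.
Under the noise law the probability of a transcript is thus the product over
the samples of the masses of the cells, and replacing the noise law by the law
with spike j multiplies the i-th factor by the mean of the likelihood ratio
exp (lambda x_j - lambda ^ 2 / 2) over the i-th cell.

From transcripts to second moments.  Let 1 + a_i be these mean likelihood
ratios.  For a_i >= -1 one has
1 - prod_i (1 + a_i) <= |sum_i a_i| + 4 sum_i a_i ^ 2 ([one_sub_prod_le]),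
and given the transcript the a_i are conditional expectations of centred
functions of independent samples, hence orthogonal ([sum_null_score_sqr]).  So
the increase in the probability of any event is controlled by the sum over i of
the second moments of a_i ([alternative_le_null]).

From second moments to bits.  Summed over j, the squares of the conditional
means of bounded, centred, independent functions of the entries satisfy the
level-one inequality sum_j a_ij ^ 2 <= 16 M ^ 2 ln (1 / mass of the cell)
([level_one_inequality]), and the mean of the logarithm is at most the
logarithm of the number of ways in which one sample can act on the transcript,
that is T s ln 2 ([sum_null_ln_mass], [sum_consistent_others]).  Altogether the
average over j of the error is of order N M ^ 2 T s / D.

The Gaussian likelihood ratio is unbounded.  It is rounded down to a multiple
of 1 / n and capped at M; this keeps only a lower bound for the probabilities
under a spike, which suffices because the argument bounds the complement of the
event from below.  The mass delta lost in this way is at most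
1 / n + C_p M ^ (- p) for every p ([lost_mass_le]).  With M close to d ^ eps,
n a large power of d and p large, N delta tends to 0, and N M ^ 2 T s / D is of
order d ^ (eta + tau + b + 2 eps - k), which tends to 0 for small eps. *)

(** * Rectangular protocols *)

(** If some factor is below 1 / 2, its square alone makes the right-hand side at
least 1.  Otherwise 1 + y >= exp (y - 2 y ^ 2) for every factor, since
(1 + y) (1 - y + 2 y ^ 2) = 1 + y ^ 2 (1 + 2 y) >= 1, and the product is at
least exp (sum a - 2 sum a ^ 2) >= 1 + sum a - 2 sum a ^ 2. *)
Lemma one_sub_prod_le (R : realType) (I : finType) (a : I -> R) :
  (forall i, -1 <= a i) ->
  1 - \prod_i (1 + a i) <= `|\sum_i a i| + 4 * \sum_i a i ^+ 2.
Proof.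
move=> a1.
have sq0 : forall i, 0 <= a i ^+ 2 by move=> i; exact: sqr_ge0.
case: (pselect (exists i, a i < - (1 / 2))) => [[i ai]|/forallNP ai].
  have : 0 <= \prod_i (1 + a i) by apply: prodr_ge0 => j _; have := a1 j; lra.
  have : a i ^+ 2 <= \sum_i a i ^+ 2.
    by rewrite (bigD1 i)//= lerDl; apply: sumr_ge0 => j _; exact: sq0.
  have := normr_ge0 (\sum_i a i); nra.
have : expR (\sum_i (a i - 2 * a i ^+ 2)) <= \prod_i (1 + a i).
  rewrite expR_sum; apply: ler_prod => i _; rewrite expR_ge0/=.
  have /negP := ai i; rewrite -leNgt => hi.
  have e0 := expR_gt0 (a i - 2 * a i ^+ 2).
  have := expR_ge1Dx (- (a i - 2 * a i ^+ 2)); rewrite expRN => h.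
  rewrite -(@ler_pM2r _ (expR (a i - 2 * a i ^+ 2))^-1) ?invr_gt0//.
  rewrite divff ?gt_eqF//; apply: (@le_trans _ _ ((1 + a i) * (1 - (a i - 2 * a i ^+ 2)))).
    by have := sq0 i; nra.
  by apply: ler_wpM2l => //; lra.
have := expR_ge1Dx (\sum_i (a i - 2 * a i ^+ 2)).
rewrite sumrB -mulr_sumr.
have : 0 <= \sum_i a i ^+ 2 by apply: sumr_ge0 => j _; exact: sq0.
have := ler_norm (- \sum_i a i); rewrite normrN; lra.
Qed.

(** A protocol in which the inputs that produce a given transcript form a product
set.  The cell of machine i at transcript tr is {x | A i tr x}; the hypothesis
[transcript_of], tested on all functions G of the outcome, says at once that
every input tuple has exactly one transcript and that the outcome is read off
from it. *)
Section rectangular_protocol.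
Variables (R : realType) (I F Tr Z : finType).
Variables (A : I -> Tr -> pred F) (out : Tr -> Z) (run : {ffun I -> F} -> Z).
Hypothesis transcript_of : forall (x : {ffun I -> F}) (G : Z -> R),
  \sum_tr G (out tr) * \prod_i (A i tr (x i))%:R = G (run x).

Definition cell_mass (u : F -> R) (i : I) (tr : Tr) : R :=
  \sum_(x | A i tr x) u x.

(** Distributivity alone, so u may be signed.  With some of the u i replaced by a
centred function this becomes the orthogonality of the scores. *)
Lemma sum_transcripts (u : I -> F -> R) (G : Z -> R) :
  \sum_tr G (out tr) * \prod_i cell_mass (u i) i tr =
  \sum_(x : {ffun I -> F}) G (run x) * \prod_i u i (x i).
Proof.
under eq_bigr => tr _.
  rewrite /cell_mass.
  under eq_bigr => i _ do rewrite big_mkcond/=.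
  rewrite bigA_distr_bigA mulr_sumr.
  over.
rewrite exchange_big/=; apply: eq_bigr => x _.
rewrite -[in RHS](transcript_of x G) mulr_suml; apply: eq_bigr => tr _.
rewrite -mulrA -big_split/=; congr (_ * _); apply: eq_bigr => i _.
by case: (A i tr (x i)); rewrite ?mul1r ?mul0r.
Qed.

Lemma sum_transcripts1 (u : I -> F -> R) :
  \sum_tr \prod_i cell_mass (u i) i tr = \prod_i \sum_x u i x.
Proof.
rewrite bigA_distr_bigA; have := sum_transcripts u (fun=> 1).
under eq_bigr do rewrite mul1r.
by under [X in _ = X -> _]eq_bigr do rewrite mul1r.
Qed.

Variables (p : I -> F -> R).
Hypothesis p_ge0 : forall i x, 0 <= p i x.
Hypothesis p_sum1 : forall i, \sum_x p i x = 1.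

Let mass i tr := cell_mass (p i) i tr.
Let null tr := \prod_i mass i tr.

Let mass_ge0 i tr : 0 <= mass i tr.
Proof. by apply: sumr_ge0 => x _. Qed.

Let null_ge0 tr : 0 <= null tr.
Proof. by apply: prodr_ge0 => i _. Qed.

Let null_sum1 : \sum_tr null tr = 1.
Proof. by rewrite sum_transcripts1 big1. Qed.

(** The information that the transcript carries about one machine, in expectation
under the null law.  By concavity of the logarithm it is at most the logarithm
of the mean of 1 / mass, and this mean forgets the constraint on machine i: it
is the expected number of transcripts compatible with all the other inputs. *)
Lemma sum_null_ln_mass (C : R) i :
  0 < C ->
  (forall x : {ffun I -> F},
    \sum_tr \prod_(i' | i' != i) (A i' tr (x i'))%:R <= C) ->
  \sum_tr null tr * - ln (mass i tr) <= ln C.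
Proof.
move=> C0 HC.
have step tr : null tr * - ln (mass i tr) <=
    C^-1 * \prod_(i' | i' != i) mass i' tr + null tr * (ln C - 1).
  have rest0 : 0 <= \prod_(i' | i' != i) mass i' tr by apply: prodr_ge0.
  (* ln y <= y - 1 at y = 1 / (C * mass), weighted by null *)
  have [m0|m0] := eqVneq (mass i tr) 0.
    rewrite /null (bigD1 i)//= m0 !mul0r addr0 mulr_ge0 ?invr_ge0//; exact: ltW.
  have {}m0 : 0 < mass i tr by rewrite lt0r m0 mass_ge0.
  have Cm : 0 < (C * mass i tr)^-1 by rewrite invr_gt0 mulr_gt0.
  have := expR_ge1Dx (ln ((C * mass i tr)^-1)).
  rewrite lnK ?posrE// lnV ?posrE ?mulr_gt0// lnM ?posrE// => hln.
  have -> : C^-1 * \prod_(i' | i' != i) mass i' tr = null tr * (C * mass i tr)^-1.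
    have -> : null tr = mass i tr * \prod_(i' | i' != i) mass i' tr.
      by rewrite /null (bigD1 i).
    by field; rewrite !gt_eqF.
  rewrite -mulrDr; apply: ler_wpM2l; first exact: null_ge0.
  lra.
apply: (le_trans (ler_sum _ (fun tr _ => step tr))).
rewrite big_split/= -mulr_sumr -mulr_suml null_sum1 mul1r.
suff : C^-1 * \sum_tr \prod_(i' | i' != i) mass i' tr <= 1 by lra.
rewrite mulrC ler_pdivrMr// mul1r.
have -> : \sum_tr \prod_(i' | i' != i) mass i' tr =
    \sum_(x : {ffun I -> F}) (\prod_i' p i' (x i')) *
       \sum_tr \prod_(i' | i' != i) (A i' tr (x i'))%:R.
  under [RHS]eq_bigr do rewrite mulr_sumr.
  rewrite exchange_big/=; apply: eq_bigr => tr _.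
  transitivity (\prod_i' \sum_x p i' x * (if i' != i then (A i' tr x)%:R else 1)).
    rewrite [RHS](bigD1 i)//= [X in _ = X * _](_ : _ = 1); last first.
      by rewrite eqxx/=; under eq_bigr do rewrite mulr1.
    rewrite mul1r; apply: eq_bigr => i' /negbTE i'i; rewrite i'i/=.
    rewrite /mass /cell_mass big_mkcond; apply: eq_bigr => x _.
    by case: ifP; rewrite ?mulr1 ?mulr0.
  rewrite bigA_distr_bigA; apply: eq_bigr => x _.
  rewrite big_split/=; congr (_ * _).
  by rewrite [RHS]big_mkcond.
apply: (@le_trans _ _ (\sum_(x : {ffun I -> F}) (\prod_i' p i' (x i')) * C)).
  by apply: ler_sum => x _; apply: ler_wpM2l => //; apply: prodr_ge0.
rewrite -mulr_suml -bigA_distr_bigA/= big1 ?mul1r//.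
Qed.

(** An alternative law nu whose density with respect to p is bounded below by
(1 - delta) + h / p, with h centred under p.  A lower bound is enough to bound
from above the probability of an event, through its complement; and it may lose
the mass delta, which allows h / p to be bounded even when the density of nu is
not. *)
Section one_alternative.
Variables (h nu : I -> F -> R) (delta kappa : R).
Hypothesis h_sum0 : forall i, \sum_x h i x = 0.
Hypothesis h_null : forall i tr, mass i tr = 0 -> cell_mass (h i) i tr = 0.
Hypothesis lik_ge0 : forall i x, 0 <= (1 - delta) * p i x + h i x.
Hypothesis lik_le : forall i x, (1 - delta) * p i x + h i x <= nu i x.
Hypothesis nu_sum1 : forall i, \sum_x nu i x = 1.
Hypothesis delta_ge0 : 0 <= delta.
Hypothesis kappa_gt0 : 0 < kappa.

(** The conditional mean of h i / p i given the transcript. *)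
Definition score i tr := cell_mass (h i) i tr / mass i tr.

Let scoreK i tr : mass i tr * score i tr = cell_mass (h i) i tr.
Proof.
rewrite /score mulrC; have [m0|m0] := eqVneq (mass i tr) 0.
  by rewrite m0 mulr0 h_null.
by rewrite divfK.
Qed.

(** Given the transcript the inputs stay independent, so a cross term is the
expectation of a product of two centred functions of different inputs. *)
Lemma sum_null_score_sqr :
  \sum_tr null tr * (\sum_i score i tr) ^+ 2 =
  \sum_i \sum_tr null tr * score i tr ^+ 2.
Proof.
under eq_bigr do rewrite expr2 mulr_suml mulr_sumr.
rewrite exchange_big/=; apply: eq_bigr => i _.
under eq_bigr do rewrite mulr_sumr mulr_sumr.
rewrite exchange_big/= (bigD1 i)//= [X in _ + X]big1 ?addr0.
  by apply: eq_bigr => tr _; rewrite expr2.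
move=> i' i'i.
transitivity (\sum_tr \prod_l cell_mass
    ((fun l => if (l == i) || (l == i') then h l else p l) l) l tr).
  apply: eq_bigr => tr _.
  rewrite /null (bigD1 i)//= (bigD1 i')//= [RHS](bigD1 i)//= [in RHS](bigD1 i')//=.
  rewrite !eqxx/= orbT -!scoreK.
  have -> : \prod_(l | (l != i) && (l != i')) cell_mass
      (if (l == i) || (l == i') then h l else p l) l tr =
      \prod_(l | (l != i) && (l != i')) mass l tr.
    by apply: eq_bigr => l /andP[/negbTE-> /negbTE->].
  by ring.
by rewrite sum_transcripts1 (bigD1 i)//= eqxx/= h_sum0 mul0r.
Qed.

Lemma alternative_le_null (E : pred Z) :
  \sum_(x : {ffun I -> F}) (E (run x))%:R * \prod_i nu i (x i) <=
  \sum_(x : {ffun I -> F}) (E (run x))%:R * \prod_i p i (x i) +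
  (#|I|%:R * delta + 8 * #|I|%:R * delta ^+ 2 + kappa / 2 +
   ((2 * kappa)^-1 + 8) * \sum_i \sum_tr null tr * score i tr ^+ 2).
Proof.
pose lik i x := (1 - delta) * p i x + h i x.
have likE i tr : cell_mass (lik i) i tr = mass i tr * (1 + (score i tr - delta)).
  rewrite /cell_mass big_split/= -mulr_sumr -/(cell_mass (p i) i tr) -/(mass i tr).
  by rewrite -/(cell_mass (h i) i tr) -scoreK; ring.
(* on a cell of mass 0 the bound -1 <= score - delta may fail, hence the default value *)
pose L i tr := if mass i tr == 0 then 0 else score i tr - delta.
have massL i tr : mass i tr * (1 + (score i tr - delta)) = mass i tr * (1 + L i tr).
  by rewrite /L; case: eqP => // ->; rewrite !mul0r.
have L1 i tr : -1 <= L i tr.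
  rewrite /L; case: eqP => [_|/eqP m0]; first lra.
  have m1 : 0 < mass i tr by rewrite lt0r m0 mass_ge0.
  have : 0 <= cell_mass (lik i) i tr by apply: sumr_ge0 => x _; exact: lik_ge0.
  by rewrite likE pmulr_rge0//; lra.
have comp : \sum_(x : {ffun I -> F}) (E (run x))%:R * \prod_i nu i (x i) =
   1 - \sum_(x : {ffun I -> F}) (~~ E (run x))%:R * \prod_i nu i (x i).
  apply/eqP; rewrite eq_sym subr_eq -big_split/=; apply/eqP.
  transitivity (\sum_(x : {ffun I -> F}) \prod_i nu i (x i)).
    by rewrite -bigA_distr_bigA/= big1.
  by apply: eq_bigr => x _; rewrite -mulrDl; case: (E _); rewrite /= ?addr0 ?add0r mul1r.
rewrite comp.
have lo : \sum_tr (~~ E (out tr))%:R * (null tr * \prod_i (1 + L i tr)) <=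
    \sum_(x : {ffun I -> F}) (~~ E (run x))%:R * \prod_i nu i (x i).
  rewrite [leLHS](_ : _ = \sum_tr (~~ E (out tr))%:R * \prod_i cell_mass (lik i) i tr).
    rewrite (sum_transcripts lik (fun z => (~~ E z)%:R)); apply: ler_sum => x _.
    apply: ler_wpM2l => //; apply: ler_prod => i _.
    by rewrite lik_ge0/=; exact: lik_le.
  apply: eq_bigr => tr _; congr (_ * _); rewrite -big_split/=.
  by apply: eq_bigr => i _; rewrite likE massL.
rewrite -(sum_transcripts p (fun z => (E z)%:R)).
have aux tr : null tr - (~~ E (out tr))%:R * (null tr * \prod_i (1 + L i tr)) <=
    (E (out tr))%:R * null tr +
    (null tr * (#|I|%:R * delta + 8 * #|I|%:R * delta ^+ 2 + kappa / 2) +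
     (null tr * (\sum_i score i tr) ^+ 2 * (2 * kappa)^-1 +
      8 * \sum_i null tr * score i tr ^+ 2)).
  have [n0|n0] := eqVneq (null tr) 0.
    rewrite n0 !mul0r !mulr0 subr0 !add0r.
    by rewrite big1 ?mulr0// => i _; rewrite mul0r.
  have LE i : L i tr = score i tr - delta.
    rewrite /L; case: eqP => // m0; case/eqP: n0.
    by rewrite /null (bigD1 i)//= m0 mul0r.
  have k2 : 0 < 2 * kappa by rewrite mulr_gt0.
  have : 1 - \prod_i (1 + L i tr) <=
     (#|I|%:R * delta + 8 * #|I|%:R * delta ^+ 2 + kappa / 2) +
     ((\sum_i score i tr) ^+ 2 * (2 * kappa)^-1 + 8 * \sum_i score i tr ^+ 2).
    apply: (le_trans (one_sub_prod_le (a := L^~ tr) (fun i => L1 i tr))) => /=.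
    have -> : \sum_i L i tr = \sum_i score i tr - #|I|%:R * delta.
      under eq_bigr do rewrite LE.
      by rewrite sumrB sumr_const mulr_natl.
    have h1 : \sum_i L i tr ^+ 2 <= 2 * \sum_i score i tr ^+ 2 + 2 * #|I|%:R * delta ^+ 2.
      rewrite mulr_sumr -mulrA (_ : #|I|%:R * _ = \sum_(i : I) delta ^+ 2); last first.
        by rewrite sumr_const mulr_natl.
      rewrite mulr_sumr -big_split/=; apply: ler_sum => i _; rewrite LE.
      by have := sqr_ge0 (score i tr + delta); lra.
    set S := \sum_i score i tr.
    have h2 : `|S - #|I|%:R * delta| <= `|S| + #|I|%:R * delta.
      apply: (le_trans (ler_normB _ _)); rewrite lerD2l ger0_norm//.
      by rewrite mulr_ge0.
    (* the inequality of arithmetic and geometric means, with free weight kappa *)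
    have h3 : `|S| <= S ^+ 2 * (2 * kappa)^-1 + kappa / 2.
      have := sqr_ge0 (`|S| - kappa); rewrite sqrrB real_normK ?num_real// => h3.
      have -> : S ^+ 2 * (2 * kappa)^-1 + kappa / 2 = (S ^+ 2 + kappa ^+ 2) / (2 * kappa).
        by field; rewrite gt_eqF.
      by rewrite ler_pdivlMr//; lra.
    lra.
  move/(ler_wpM2l (null_ge0 tr)).
  rewrite -mulr_sumr => h4.
  case: (E (out tr)) => /=; last lra.
  rewrite mul0r subr0 mul1r lerDl.
  have D0 : 0 <= #|I|%:R * delta by rewrite mulr_ge0.
  have D1 : 0 <= 8 * #|I|%:R * delta ^+ 2 by rewrite mulr_ge0 ?sqr_ge0// mulr_ge0.
  have D2 : 0 <= null tr * (\sum_i score i tr) ^+ 2 / (2 * kappa).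
    by rewrite mulr_ge0 ?invr_ge0 ?(ltW k2)// mulr_ge0 ?sqr_ge0.
  have D3 : 0 <= null tr * (\sum_i score i tr ^+ 2).
    by rewrite mulr_ge0// sumr_ge0// => i _; exact: sqr_ge0.
  have D4 : 0 <= null tr * (#|I|%:R * delta + 8 * #|I|%:R * delta ^+ 2 + kappa / 2).
    by rewrite mulr_ge0//; lra.
  lra.
have := @ler_sum R Tr (index_enum Tr) xpredT _ _ (fun tr _ => aux tr).
rewrite sumrB null_sum1 !big_split/= -!mulr_suml null_sum1 sum_null_score_sqr.
rewrite -mulr_sumr [\sum_tr \sum_i _]exchange_big/= => h5.
lra.
Qed.

End one_alternative.
End rectangular_protocol.

(** * The level-one inequality and streaming transcripts *)

(** The growth of the exponential beyond its tangent at 0 is absorbed by a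
Gaussian exponent, so a bounded centred variable is subgaussian: taking
expectations kills the linear term.  Below 3 / 4 this is
exp y <= 1 / (1 - y) <= 1 + y + 4 y ^ 2; above it, y <= 4 y ^ 2. *)
Lemma expR_le_addr_expR_sqr (R : realType) (y : R) :
  expR y <= y + expR (4 * y ^+ 2).
Proof.
have [y34|y34] := leP y (3 / 4); last first.
  have : expR y <= expR (4 * y ^+ 2) by rewrite ler_expR; nra.
  by lra.
have h1 : expR y * (1 - y) <= 1.
  have := expR_ge1Dx (- y); have := expR_gt0 y.
  by rewrite expRN => e0 le1; rewrite mulrC -ler_pdivlMr// div1r.
have h2 : 1 + 4 * y ^+ 2 <= expR (4 * y ^+ 2) by exact: expR_ge1Dx.
suff : expR y <= 1 + y + 4 * y ^+ 2 by lra.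
have y1 : 0 < 1 - y by lra.
rewrite -(ler_pM2r y1); apply: (le_trans h1); nra.
Qed.

Section level_one.
Variables (R : realType) (J Q Om : finType).
Variables (mu : Om -> R) (q : J -> Om -> Q) (gam c : Q -> R) (M : R).
Hypothesis mu_ge0 : forall o, 0 <= mu o.
Hypothesis q_indep : forall g : J -> Q -> R,
  \sum_o mu o * \prod_j g j (q j o) = \prod_j \sum_r gam r * g j r.
Hypothesis gam_ge0 : forall r, 0 <= gam r.
Hypothesis gam_sum1 : \sum_r gam r = 1.
Hypothesis c_mean0 : \sum_r gam r * c r = 0.
Hypothesis M_gt0 : 0 < M.
Hypothesis c_le : forall r, `|c r| <= M.

(** The linear term of [expR_le_addr_expR_sqr] averages to 0, which leaves a bound
of second order in a. *)
Lemma mgf_le (a : R) :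
  \sum_r gam r * expR (a * c r) <= expR (4 * a ^+ 2 * M ^+ 2).
Proof.
have step r : gam r * expR (a * c r) <=
    a * (gam r * c r) + gam r * expR (4 * a ^+ 2 * M ^+ 2).
  rewrite mulrCA -mulrDr; apply: ler_wpM2l => //.
  apply: (le_trans (expR_le_addr_expR_sqr _)); rewrite lerD2l ler_expR.
  rewrite exprMn mulrA; apply: ler_wpM2l; first by rewrite mulr_ge0 ?sqr_ge0.
  by rewrite -real_normK ?num_real// lerXn2r ?nnegrE//; exact: ltW.
apply: (le_trans (ler_sum _ (fun r _ => step r))).
by rewrite big_split/= -mulr_sumr c_mean0 mulr0 add0r -mulr_suml gam_sum1 mul1r.
Qed.

(** Let a_j be the mean of c (q j) given the event S, and m the probability of S.
The exponential moment of th * sum_j a_j c (q j) factors by independence and is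
at most exp (4 M ^ 2 th ^ 2 sum_j a_j ^ 2); by Jensen's inequality it is at
least m exp (th sum_j a_j ^ 2).  Comparing the exponents bounds
sum_j a_j ^ 2 by a multiple of ln (1 / m). *)
Lemma level_one_inequality (S : pred Om) :
  \sum_j (\sum_(o | S o) mu o * c (q j o)) ^+ 2 <=
  (\sum_(o | S o) mu o) ^+ 2 * (16 * M ^+ 2 * - ln (\sum_(o | S o) mu o)).
Proof.
set m := \sum_(o | S o) mu o.
have m_ge0 : 0 <= m by apply: sumr_ge0.
have [m0|m_neq0] := eqVneq m 0.
  rewrite m0 expr0n/= mul0r big1// => j _; rewrite big1 ?expr0n// => o So.
  suff -> : mu o = 0 by rewrite mul0r.
  by move/eqP: m0; rewrite psumr_eq0// => /allP/(_ o (mem_index_enum _))/implyP/(_ So)/eqP.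
have m_gt0 : 0 < m by rewrite lt0r m_neq0.
pose a j := (\sum_(o | S o) mu o * c (q j o)) / m.
pose s := \sum_j a j ^+ 2.
have -> : \sum_j (\sum_(o | S o) mu o * c (q j o)) ^+ 2 = m ^+ 2 * s.
  rewrite mulr_sumr; apply: eq_bigr => j _.
  by rewrite /a expr_div_n mulrC divfK// expf_neq0.
apply: ler_wpM2l; first exact: sqr_ge0.
(* th minimises 4 M ^ 2 th ^ 2 s - th s *)
pose th : R := (8 * M ^+ 2)^-1.
have M2 : 0 < M ^+ 2 by rewrite exprn_gt0.
have th_gt0 : 0 < th by rewrite invr_gt0 mulr_gt0.
have up : \sum_(o | S o) mu o * \prod_j expR (th * a j * c (q j o)) <=
    expR (4 * M ^+ 2 * th ^+ 2 * s).
  apply: (@le_trans _ _ (\sum_o mu o * \prod_j expR (th * a j * c (q j o)))).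
    rewrite big_mkcond/=; apply: ler_sum => o _; case: ifP => // _.
    by rewrite mulr_ge0// prodr_ge0// => j _; exact: expR_ge0.
  rewrite (q_indep (fun j r => expR (th * a j * c r))) mulr_sumr expR_sum.
  apply: ler_prod => j _; apply/andP; split.
    by apply: sumr_ge0 => r _; rewrite mulr_ge0// expR_ge0.
  by apply: (le_trans (mgf_le _)); rewrite ler_expR exprMn; lra.
have lo : expR (th * s) * m <=
    \sum_(o | S o) mu o * \prod_j expR (th * a j * c (q j o)).
  (* tangent line of expR at th * s, the conditional mean of the exponent *)
  have tangent x : expR (th * s) * (1 + x - th * s) <= expR x.
    rewrite -[leRHS](_ : expR (th * s) * expR (x - th * s) = _); last first.
      by rewrite -expRD; congr expR; ring.
    by apply: ler_wpM2l; [exact: expR_ge0|rewrite -addrA expR_ge1Dx].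
  apply: (@le_trans _ _ (\sum_(o | S o) mu o *
      (expR (th * s) * (1 + \sum_j th * a j * c (q j o) - th * s)))); last first.
    by apply: ler_sum => o _; apply: ler_wpM2l => //; rewrite -expR_sum.
  rewrite le_eqVlt; apply/orP; left; apply/eqP.
  under eq_bigr do rewrite mulrCA.
  rewrite -mulr_sumr; congr (_ * _).
  under eq_bigr do rewrite mulrBr mulrDr mulr1.
  rewrite sumrB big_split/= -mulr_suml -/m.
  suff -> : \sum_(o | S o) mu o * (\sum_j th * a j * c (q j o)) = m * (th * s) by ring.
  under eq_bigr do rewrite mulr_sumr.
  rewrite exchange_big/= !mulr_sumr; apply: eq_bigr => j _.
  transitivity (th * a j * \sum_(o | S o) mu o * c (q j o)).
    by rewrite mulr_sumr; apply: eq_bigr => o _; ring.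
  by rewrite /a; field.
have := le_trans lo up.
rewrite -[m in X in X -> _](lnK m_gt0) -expRD ler_expR.
have -> : 4 * M ^+ 2 * th ^+ 2 * s = th * s / 2 by rewrite /th; field; rewrite gt_eqF.
move=> h; rewrite -(ler_pM2l th_gt0).
have -> : th * (16 * M ^+ 2 * - ln m) = - 2 * ln m by rewrite /th; field; rewrite gt_eqF.
lra.
Qed.

End level_one.

(** A sample is represented by its response, which sends a pass and a memory state
to the next memory state; [steps] lists the pass and the sample of every update
in chronological order. *)
Section streaming.
Variables (R : realType) (K I S : finType).
Local Notation F := {ffun K * S -> S}.

Fixpoint final_state (steps : seq (K * I)) (m : S) (x : I -> F) : S :=
  if steps is (t, i) :: steps' then final_state steps' (x i (t, m)) x else m.

(** The memory states after each update, as a nested product: the recursion on the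
list of steps then splits a sum over transcripts by pair_bigA. *)
Fixpoint transcript (n : nat) : finType :=
  if n is n'.+1 then (S * transcript n')%type else unit.

Fixpoint transcript_out (n : nat) (m : S) : transcript n -> S :=
  if n is n'.+1 then fun tr : S * transcript n' => transcript_out tr.1 tr.2
  else fun=> m.

(** Sample i could have produced its own entries of the transcript, the others
being taken as given.  This depends on the sample only through its response, and
the conjunction over all i says that the transcript is the actual one. *)
Fixpoint consistent (steps : seq (K * I)) (m : S) (i : I) :
    transcript (size steps) -> pred F :=
  if steps is (t, i') :: steps' then
    fun (tr : S * transcript (size steps')) x =>
      ((i' == i) ==> (x (t, m) == tr.1)) && consistent tr.1 i tr.2 x
  else fun=> xpredT.

Lemma sum_consistent (steps : seq (K * I)) (m : S) (x : I -> F) (G : S -> R) :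
  \sum_(tr : transcript (size steps)) G (transcript_out m tr) *
     \prod_i (consistent m i tr (x i))%:R = G (final_state steps m x).
Proof.
elim: steps m => [|[t i'] steps IH] m /=.
  by rewrite (big_pred1 tt) => [|[]//]; rewrite big1 ?mulr1.
rewrite -(pair_bigA _ (fun m' tr => G (transcript_out m' tr) *
   \prod_i (((i' == i) ==> (x i (t, m) == m')) && consistent m' i tr (x i))%:R))/=.
rewrite (bigD1 (x i' (t, m)))//= [X in _ + X]big1 ?addr0.
  rewrite -IH; apply: eq_bigr => tr _; congr (_ * _); apply: eq_bigr => i _.
  by case: (eqVneq i' i) => //= <-; rewrite eqxx.
move=> m' m'N; apply: big1 => tr _.
by rewrite (bigD1 i')//= eqxx/= eq_sym (negbTE m'N) mul0r mulr0.
Qed.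

(** When the constraint of sample i is dropped, every update made by another sample
is forced and every update made by sample i is free, which leaves one choice in
S for each of its updates. *)
Lemma sum_consistent_others (steps : seq (K * I)) (m : S) (x : I -> F) (i : I) :
  \sum_(tr : transcript (size steps))
     \prod_(i' | i' != i) (consistent m i' tr (x i'))%:R <=
  #|S|%:R ^+ count_mem i (map snd steps) :> R.
Proof.
elim: steps m => [|[t i'] steps IH] m /=.
  by rewrite (big_pred1 tt) => [|[]//]; rewrite expr0 big1.
rewrite -(pair_bigA _ (fun m' tr =>
   \prod_(i0 | i0 != i) (((i' == i0) ==> (x i0 (t, m) == m')) &&
      consistent m' i0 tr (x i0))%:R))/=.
have [->|i'i] := eqVneq i' i; last first.
  rewrite (bigD1 (x i' (t, m)))//= [X in _ + X]big1 ?addr0; last first.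
    move=> m' m'N; apply: big1 => tr _.
    by rewrite (bigD1 i')//= eqxx/= eq_sym (negbTE m'N) mul0r.
  apply: le_trans (IH (x i' (t, m))); apply: ler_sum => tr _.
  apply: ler_prod => i0 _; rewrite ler0n/= ler_nat.
  by case: consistent; rewrite ?andbT ?andbF// leq_b1.
rewrite exprS mulr_natl -sumr_const.
apply: ler_sum => m' _; apply: le_trans (IH m').
apply: ler_sum => tr _; apply: ler_prod => i0 i0i.
by rewrite eq_sym (negbTE i0i)/= ler0n lexx.
Qed.
End streaming.

Section streaming_bound.
Variables (R : realType) (K I J S : finType) (steps : seq (K * I)) (m0 : S).
Local Notation F := {ffun K * S -> S}.
Variables (p : I -> F -> R) (h nu : I -> J -> F -> R) (n : nat) (B delta kappa : R).
Hypothesis visits : forall i, count_mem i (map snd steps) = n.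
Hypothesis p_ge0 : forall i x, 0 <= p i x.
Hypothesis p_sum1 : forall i, \sum_x p i x = 1.
Hypothesis h_sum0 : forall i j, \sum_x h i j x = 0.
Hypothesis lik_ge0 : forall i j x, 0 <= (1 - delta) * p i x + h i j x.
Hypothesis lik_le : forall i j x, (1 - delta) * p i x + h i j x <= nu i j x.
Hypothesis nu_sum1 : forall i j, \sum_x nu i j x = 1.
Hypothesis B_ge0 : 0 <= B.
Hypothesis delta_ge0 : 0 <= delta.
Hypothesis kappa_gt0 : 0 < kappa.
Hypothesis level_one : forall i (C : pred F),
  \sum_j (\sum_(x | C x) h i j x) ^+ 2 <=
  (\sum_(x | C x) p i x) ^+ 2 * (B * - ln (\sum_(x | C x) p i x)).

(** The average over j is where the level-one inequality enters: for one j the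
second moment of the score may be large, but summed over j it is at most B times
the information about the sample in the transcript. *)
Theorem alternatives_le_null (E : J -> pred S) :
  \sum_j \sum_(x : {ffun I -> F}) (E j (final_state steps m0 x))%:R * \prod_i nu i j (x i) <=
  \sum_j \sum_(x : {ffun I -> F}) (E j (final_state steps m0 x))%:R * \prod_i p i (x i) +
  (#|J|%:R * (#|I|%:R * delta + 8 * #|I|%:R * delta ^+ 2 + kappa / 2) +
   ((2 * kappa)^-1 + 8) * (#|I|%:R * (B * (n%:R * ln #|S|%:R)))).
Proof.
pose A i tr := consistent (steps := steps) m0 i tr.
have tof x (G : S -> R) : \sum_(tr : transcript S (size steps)) G (transcript_out m0 tr) *
   \prod_i (A i tr (x i))%:R = G (final_state steps m0 x).
  exact: sum_consistent.
pose run (x : {ffun I -> F}) := final_state steps m0 x.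
have cell i j tr : cell_mass A (p i) i tr = 0 -> cell_mass A (h i j) i tr = 0.
  rewrite /cell_mass => p0; have := level_one i (A i tr).
  rewrite p0 expr0n/= mul0r => le0; apply/eqP; rewrite -sqrf_eq0 eq_le.
  rewrite sqr_ge0 andbT; apply: le_trans le0.
  by rewrite (bigD1 j)//= lerDl; apply: sumr_ge0 => j' _; exact: sqr_ge0.
have := @ler_sum R J (index_enum J) xpredT _ _ (fun j _ => @alternative_le_null R I F
  (transcript S (size steps)) S A (transcript_out m0) run tof p p_ge0 p_sum1
  (fun i => h i j) (fun i => nu i j) delta kappa
  (fun i => h_sum0 i j) (fun i => cell i j) (fun i => lik_ge0 i j)
  (fun i => lik_le i j) (fun i => nu_sum1 i j) delta_ge0 kappa_gt0 (E j)).
move=> /le_trans; apply.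
rewrite big_split/= lerD2l big_split/= sumr_const [#|J|%:R * _]mulr_natl lerD2l -mulr_sumr.
apply: ler_wpM2l; first by rewrite addr_ge0// invr_ge0 mulr_ge0// ltW.
rewrite exchange_big/= [leRHS]mulr_natl -sumr_const; apply: ler_sum => i _.
rewrite exchange_big/=.
have C0 : 0 < #|S|%:R ^+ n :> R.
  by rewrite exprn_gt0// ltr0n; apply/card_gt0P; exists m0.
have := @sum_null_ln_mass R I F (transcript S (size steps)) S A (transcript_out m0) run tof
  p p_ge0 p_sum1 (#|S|%:R ^+ n) i C0 _.
rewrite lnXn; last by rewrite ltr0n; apply/card_gt0P; exists m0.
rewrite -[ln _ *+ n]mulr_natl => le1.
apply: (@le_trans _ _ (B * \sum_tr (\prod_i cell_mass A (p i) i tr) *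
   - ln (cell_mass A (p i) i tr))); last first.
  apply: ler_wpM2l => //; apply: le1 => x.
  by rewrite -(visits i); exact: sum_consistent_others.
rewrite mulr_sumr; apply: ler_sum => tr _.
rewrite -mulr_sumr mulrCA; apply: ler_wpM2l.
  by apply: prodr_ge0 => i' _; apply: sumr_ge0.
have [m0'|mN] := eqVneq (cell_mass A (p i) i tr) 0.
  rewrite m0' ln0// oppr0 mulr0 big1// => j _.
  by rewrite /score m0' invr0 mulr0 expr0n.
have mp : 0 < cell_mass A (p i) i tr by rewrite lt0r mN sumr_ge0.
have := level_one i (A i tr); rewrite -/(cell_mass A (p i) i tr).
rewrite -ler_pdivrMl ?exprn_gt0// mulr_sumr => /(le_trans _); apply.
by apply: ler_sum => j _; rewrite /score expr_div_n mulrC.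
Qed.

End streaming_bound.

(** * One-dimensional Gaussian laws *)

Section gaussian.
Variable R : realType.
Implicit Types (m x : R) (B : set R).

Lemma measurable_addr m :
  measurable_fun [set: measurableTypeR R] (fun x => x + m : measurableTypeR R).
Proof. exact: measurable_funD. Qed.

Lemma lebesgue_measure_addr m (B : set (measurableTypeR R)) : measurable B ->
  pushforward lebesgue_measure
    (fun x : measurableTypeR R => x + m : measurableTypeR R) B = lebesgue_measure B.
Proof.
move=> mB.
pose mu := measure_function_pushforward__canonical__measure_function_Measure
  (@lebesgue_measure R) (measurable_addr m).
suff -> : lebesgue_measure B = mu B by [].
apply: (@lebesgue_measure_unique R mu) => //= _ [[a b]] _ <-.
rewrite /pushforward (_ : _ @^-1` _ = `]a - m, b - m]%classic); last first.
  by apply/seteqP; split=> x /=; rewrite !in_itv/= ltrBlDr lerBrDr.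
rewrite !lebesgue_measure_itv/= !lte_fin ltrD2r -!EFinB.
by congr (if _ then (_)%:E else _); ring.
Qed.

Lemma normal_pdf_addr m x : normal_pdf m 1 (x + m) = normal_pdf 0 1 x.
Proof. by rewrite !normal_pdfE ?oner_neq0// /normal_fun addrK subr0. Qed.

Lemma normal_prob_addr m B : measurable B ->
  normal_prob 0 1 ((fun x => x + m) @^-1` B) = normal_prob m 1 B.
Proof.
move=> mB; rewrite /normal_prob.
under eq_integral do rewrite -(normal_pdf_addr m).
have mpdf : measurable_fun (B : set (measurableTypeR R)) (fun x => (normal_pdf m 1 x)%:E).
  by apply/measurable_EFinP; apply: measurable_funTS; exact: measurable_normal_pdf.
rewrite -[LHS](ge0_integral_pushforward (measurable_addr m) lebesgue_measure mB mpdf); last first.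
  by move=> x _; rewrite lee_fin normal_pdf_ge0.
apply: eq_measure_integral => [|maddr A mA _]; first exact: measurable_addr.
exact: lebesgue_measure_addr.
Qed.

(** Comparison of densities on B alone; all the estimates on likelihood ratios
below reduce to it. *)
Lemma le_normal_prob m1 m2 (c : R) B : measurable B -> 0 <= c ->
  (forall x, B x -> c * normal_pdf m1 1 x <= normal_pdf m2 1 x) ->
  (c%:E * normal_prob m1 1 B <= normal_prob m2 1 B)%E.
Proof.
move=> mB c0 le_pdf; rewrite /normal_prob -ge0_integralZl//; last 2 first.
- by apply/measurable_EFinP; apply: measurable_funTS; exact: measurable_normal_pdf.
- by move=> x _; rewrite lee_fin normal_pdf_ge0.
apply: ge0_le_integral => //=.
- by move=> x _; rewrite mule_ge0// lee_fin ?normal_pdf_ge0.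
- apply: measurable_funeM; apply/measurable_EFinP; apply: measurable_funTS.
  exact: measurable_normal_pdf.
- by apply/measurable_EFinP; apply: measurable_funTS; exact: measurable_normal_pdf.
Qed.

Lemma normal_pdf_ratio m1 m2 x :
  normal_pdf m2 1 x = expR ((m2 - m1) * x - (m2 ^+ 2 - m1 ^+ 2) / 2) * normal_pdf m1 1 x.
Proof.
rewrite !normal_pdfE ?oner_neq0// mulrCA /normal_fun -expRD.
by congr (_ * expR _); field.
Qed.

End gaussian.

(** * Finite-valued functions on a probability space *)

Section finite_valued.
Context d (T : measurableType d) (R : realType) (P : probability T R).

Definition prob (A : set T) : R := fine (P A).

Lemma prob_ge0 A : 0 <= prob A. Proof. by rewrite fine_ge0. Qed.

Lemma probE A : measurable A -> P A = (prob A)%:E.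
Proof. by move=> mA; rewrite fineK// fin_num_measure. Qed.

Variables (F : finType) (q : T -> F).
Hypothesis mq : forall f, measurable (q @^-1` [set f]).

Lemma measurable_fibers (A : pred F) : measurable [set x | A (q x)].
Proof.
rewrite (_ : [set _ | _] = \bigcup_(f in [set f | A f]) q @^-1` [set f]).
  exact: fin_bigcup_measurable.
by apply/seteqP; split=> [x Ax|x [f Af /= ->//]]; exists (q x).
Qed.

Lemma prob_fibers (A : pred F) :
  prob [set x | A (q x)] = \sum_(f | A f) prob (q @^-1` [set f]).
Proof.
rewrite /prob sum_fine; last by move=> f _; rewrite fin_num_measure.
congr fine; rewrite -[RHS](@big_enum _ _ _ _ A).
rewrite (_ : [set _ | _] = \bigcup_(f in [set` enum A]) q @^-1` [set f]).
  rewrite measure_fin_bigcup//; last exact: trivIset_preimage1.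
  by rewrite -fsbig_seq ?enum_uniq.
apply/seteqP; split=> [x Ax|x [f /= + ->]].
  by exists (q x) => //=; rewrite mem_enum.
by rewrite mem_enum.
Qed.

Lemma prob_fibers1 : \sum_f prob (q @^-1` [set f]) = 1.
Proof.
rewrite -(prob_fibers predT) /prob (_ : [set _ | _] = setT) ?probability_setT//.
by apply/seteqP; split.
Qed.

End finite_valued.

(** * Truncating the Gaussian likelihood ratio *)

Section likelihood_bins.
Variables (R : realType) (m : R) (n M p : nat).
Hypothesis n_gt0 : (0 < n)%N.
Hypothesis M_gt0 : (0 < M)%N.
Local Notation K := (n * M)%N.

Definition lik_ratio (x : R) := expR (m * x - m ^+ 2 / 2).

(** The likelihood ratio between the means m and 0, rounded down to a multiple of
1 / n and capped at M, is [level] of the bin of x.  Taking finitely many values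
makes every later expectation a finite sum. *)
Definition lik_bin (x : R) : 'I_K.+1 := inord (minn (Num.truncn (n%:R * lik_ratio x)) K).

Definition level (r : 'I_K.+1) : R := r%:R / n%:R.

Let nR : 0 < n%:R :> R. Proof. by rewrite ltr0n. Qed.

Let nlr_ge0 x : 0 <= n%:R * lik_ratio x.
Proof. by rewrite mulr_ge0// expR_ge0. Qed.

Lemma lik_binE x : lik_bin x = minn (Num.truncn (n%:R * lik_ratio x)) K :> nat.
Proof. by rewrite inordK// ltnS geq_minr. Qed.

Lemma measurable_lik_ratio : measurable_fun [set: R] lik_ratio.
Proof.
apply: measurableT_comp => //; apply: measurable_funD => //.
Qed.

Lemma leq_lik_bin (r : nat) x : (r <= lik_bin x)%N = (r%:R <= n%:R * lik_ratio x) && (r <= K)%N.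
Proof. by rewrite lik_binE leq_min truncn_ge_nat. Qed.

Lemma measurable_lik_bin r : measurable (lik_bin @^-1` [set r]).
Proof.
have ge_meas (s : nat) : measurable [set x | (s <= lik_bin x)%N].
  have [sK|Ks] := leqP s K; last first.
    rewrite (_ : [set _ | _] = set0)//; apply/seteqP; split=> // x/=.
    by rewrite leq_lik_bin leqNgt Ks andbF.
  rewrite (_ : [set _ | _] = (fun x => n%:R * lik_ratio x) @^-1` `[s%:R, +oo[%classic).
    rewrite -[X in measurable X]setTI; apply: measurable_funM => //.
    exact: measurable_lik_ratio.
  by apply/seteqP; split=> x /=; rewrite in_itv/= leq_lik_bin sK !andbT.
rewrite (_ : _ @^-1` _ = [set x | (r <= lik_bin x)%N] `\` [set x | (r < lik_bin x)%N]).
  exact: measurableD.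
apply/seteqP; split=> x /=; first by move=> <-; rewrite ltnn.
by move=> [rx /negP]; rewrite -leqNgt => xr; apply/val_inj/eqP; rewrite eqn_leq xr.
Qed.

Lemma level_le x : level (lik_bin x) <= lik_ratio x.
Proof. by rewrite ler_pdivrMr// mulrC; move: (leqnn (lik_bin x)); rewrite {1}leq_lik_bin => /andP[]. Qed.

Lemma lt_level x : (lik_bin x < K)%N -> lik_ratio x <= level (lik_bin x) + n%:R^-1.
Proof.
move=> xK; rewrite /level -[X in _ + X]mul1r -mulrDl ler_pdivlMr// mulrC natr1 ltW//.
by rewrite ltNge; move: (leq_lik_bin (lik_bin x).+1 x); rewrite ltnn xK andbT => <-.
Qed.

Lemma level_max x : lik_bin x = K :> nat -> M%:R <= lik_ratio x.
Proof.
move=> xK; have := level_le x; rewrite /level xK natrM mulrAC divff ?mul1r//.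
by rewrite gt_eqF.
Qed.

Definition lik_bin_prob (mu : R) (r : 'I_K.+1) : R :=
  prob (normal_prob mu 1) (lik_bin @^-1` [set r]).

(** The deficit of the mean of the truncated likelihood ratio, the untruncated one
having mean 1. *)
Definition lost_mass : R := 1 - \sum_r lik_bin_prob 0 r * level r.

Lemma level_ge0 r : 0 <= level r. Proof. by rewrite divr_ge0. Qed.

Lemma level_leM r : level r <= M%:R.
Proof. by rewrite ler_pdivrMr// -natrM ler_nat [leqRHS]mulnC -ltnS. Qed.

Lemma pdf_lik_ratio x : normal_pdf m 1 x = lik_ratio x * normal_pdf 0 1 x.
Proof. by rewrite (normal_pdf_ratio 0 m) subr0 expr0n/= subr0. Qed.

Lemma le_lik_bin_prob mu1 mu2 (c : R) r : 0 <= c ->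
  (forall x, lik_bin x = r -> c * normal_pdf mu1 1 x <= normal_pdf mu2 1 x) ->
  c * lik_bin_prob mu1 r <= lik_bin_prob mu2 r.
Proof.
move=> c0 Hr; have := le_normal_prob (measurable_lik_bin r) c0 Hr.
by rewrite !probE ?lee_fin//; exact: measurable_lik_bin.
Qed.

Lemma lik_bin_prob_shift_ge r : level r * lik_bin_prob 0 r <= lik_bin_prob m r.
Proof.
apply: le_lik_bin_prob => [|x <-]; first exact: level_ge0.
by rewrite pdf_lik_ratio ler_wpM2r ?normal_pdf_ge0// level_le.
Qed.

Lemma lik_bin_prob_shift_le (r : 'I_K.+1) : (r < K)%N ->
  lik_bin_prob m r <= (level r + n%:R^-1) * lik_bin_prob 0 r.
Proof.
move=> rK; have a0 : 0 < level r + n%:R^-1 by rewrite ltr_wpDl ?level_ge0 ?invr_gt0.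
rewrite -ler_pdivrMl//; apply: le_lik_bin_prob => [|x xr]; first by rewrite invr_ge0 ltW.
rewrite ler_pdivrMl// pdf_lik_ratio ler_wpM2r ?normal_pdf_ge0//.
by rewrite -xr lt_level// xr.
Qed.

(** Markov's inequality for lik_ratio ^ p under the shifted law.  The moment needs
no integration: lik_ratio ^ p times the density with mean m is a multiple of the
density with mean (p + 1) m. *)
Lemma lik_bin_prob_shift_max :
  lik_bin_prob m ord_max <= expR (p%:R * p.+1%:R * m ^+ 2 / 2) / M%:R ^+ p.
Proof.
set E := expR _.
have MR : 0 < M%:R ^+ p :> R by rewrite exprn_gt0// ltr0n.
have E0 : 0 < E by exact: expR_gt0.
have c0 : 0 < M%:R ^+ p / E by rewrite divr_gt0.
have : M%:R ^+ p / E * lik_bin_prob m ord_max <= lik_bin_prob (p.+1%:R * m) ord_max.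
  apply: le_lik_bin_prob => [|x xK]; first exact: ltW.
  rewrite (normal_pdf_ratio m (p.+1%:R * m)) ler_wpM2r ?normal_pdf_ge0//.
  rewrite ler_pdivrMr// -expRD.
  rewrite [X in expR X](_ : _ = p%:R * (m * x - m ^+ 2 / 2)); last first.
    by rewrite -[p.+1%:R]natr1; field.
  by rewrite expRM_natl lerXn2r ?nnegrE ?expR_ge0//; apply: level_max; rewrite xK.
move=> le1; have {le1} : M%:R ^+ p / E * lik_bin_prob m ord_max <= 1.
  apply: (le_trans le1); rewrite -lee_fin -probE//; last exact: measurable_lik_bin.
  by apply: probability_le1; exact: measurable_lik_bin.
by rewrite mulrC -ler_pdivlMr// div1r invf_div.
Qed.

Lemma lik_bin_prob_sum1 mu : \sum_r lik_bin_prob mu r = 1.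
Proof. by apply: prob_fibers1; exact: measurable_lik_bin. Qed.

Lemma lik_bin_prob_ge0 mu r : 0 <= lik_bin_prob mu r. Proof. exact: prob_ge0. Qed.

Lemma lost_mass_ge0 : 0 <= lost_mass.
Proof.
rewrite subr_ge0 -(lik_bin_prob_sum1 m); apply: ler_sum => r _.
by rewrite mulrC lik_bin_prob_shift_ge.
Qed.

Lemma lost_mass_le1 : lost_mass <= 1.
Proof.
rewrite gerBl; apply: sumr_ge0 => r _.
by rewrite mulr_ge0 ?lik_bin_prob_ge0 ?level_ge0.
Qed.

(** Rounding costs at most 1 / n in every bin but the last one, and capping costs
at most the shifted mass of the last bin. *)
Lemma lost_mass_le :
  lost_mass <= n%:R^-1 + expR (p%:R * p.+1%:R * m ^+ 2 / 2) / M%:R ^+ p.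
Proof.
rewrite lerBlDl -{1}(lik_bin_prob_sum1 m).
apply: (@le_trans _ _ (\sum_r (lik_bin_prob 0 r * level r + n%:R^-1 * lik_bin_prob 0 r +
   (r == ord_max)%:R * lik_bin_prob m ord_max))).
  apply: ler_sum => r _; have [->|rK] := eqVneq r ord_max.
    by rewrite mul1r lerDr; apply: addr_ge0; apply: mulr_ge0;
      rewrite ?invr_ge0 ?lik_bin_prob_ge0 ?level_ge0.
  rewrite mul0r addr0 mulrC -mulrDl; apply: lik_bin_prob_shift_le.
  by rewrite ltn_neqAle -ltnS ltn_ord andbT.
rewrite !big_split/= -mulr_sumr lik_bin_prob_sum1 mulr1 -mulr_suml -addrA lerD2l lerD2l.
rewrite (bigD1 ord_max)//= eqxx big1 => [|r /negbTE->//].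
by rewrite addr0 mul1r lik_bin_prob_shift_max.
Qed.

End likelihood_bins.

(** * Independence and shifts of Gaussian tensors *)

Section tensor_sigma_algebra.
Variables (R : realType) (k d : nat).
Local Notation tensor := (tensor R k d).

Definition box (B : mindex k d -> set R) : set tensor :=
  [set X : tensor | forall j, B j (X j)].

Lemma measurable_cylinder j (B : set R) : measurable B ->
  measurable [set X : tensor | B (X j)].
Proof. by move=> mB; apply: sub_sigma_algebra; exists j, B. Qed.

Lemma measurable_box B : (forall j, measurable (B j)) -> measurable (box B).
Proof.
move=> mB; rewrite (_ : box B = \bigcap_(j in [set: mindex k d]) [set X | B j (X j)]).
  by apply: fin_bigcap_measurable => // j _; exact: measurable_cylinder.
by apply/seteqP; split=> X BX j => [_|]; exact: BX.
Qed.

Lemma measurable_fun_tensor dT (T : measurableType dT) (f : T -> tensor) :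
  (forall j, measurable_fun [set: T] (fun x => f x j)) -> measurable_fun [set: T] f.
Proof.
move=> mf; apply: (measurability (@tensor_cylinders R k d)) => //.
move=> _ [_ [j [B [mB ->]]] <-].
by have := mf j measurableT B mB; rewrite setTI.
Qed.

Lemma measurable_coordinate j : measurable_fun [set: tensor] (fun X => X j).
Proof. by move=> _ B mB; rewrite setTI; exact: measurable_cylinder. Qed.

(** Boxes with measurable sides are stable under intersection and generate the
sigma-algebra. *)
Lemma tensor_measure_unique (m1 m2 : {measure set tensor -> \bar R}) :
  (m1 setT < +oo)%E ->
  (forall B, (forall j, measurable (B j)) -> m1 (box B) = m2 (box B)) ->
  forall A, measurable A -> m1 A = m2 A.
Proof.
move=> m1oo m12 A mA.
pose G := [set A | exists2 B : mindex k d -> set R,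
  (forall j, measurable (B j)) & A = box B].
have boxT : box (fun=> setT) = setT by apply/seteqP; split.
apply: (measure_unique G (fun=> setT)) => //.
- apply/seteqP; split; last first.
    apply: smallest_sub; first exact: sigma_algebra_measurable.
    by move=> _ [B mB ->]; exact: measurable_box.
  apply: smallest_sub; first exact: smallest_sigma_algebra.
  move=> _ [j [B [mB ->]]]; apply: sub_sigma_algebra.
  exists (fun j' => if j' == j then B else setT) => [j'|]; first by case: ifP.
  apply/seteqP; split=> X /=; first by move=> BX j'; case: eqP => // ->.
  by move=> /(_ j); rewrite eqxx.
- move=> _ _ [B mB ->] [C mC ->]; exists (fun j => B j `&` C j) => [j|].
    exact: measurableI.
  apply/seteqP; split=> X /= => [[BX CX] j|BCX]; first by split.
  by split=> j; have [] := BCX j.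
- by move=> _; exists (fun=> setT).
- by apply/seteqP; split=> // X _; exists 0%N.
- by move=> _ [B mB ->]; exact: m12.
Qed.

Context dO (Omega : measurableType dO) (P : probability Omega R).

(** For fixed E both sides are finite measures of A, so independence of the box
events propagates to all events of f. *)
Lemma indep_event_extend (f : Omega -> tensor) (E : set Omega) :
  measurable_fun [set: Omega] f -> measurable E ->
  (forall B, (forall j, measurable (B j)) ->
    prob P (f @^-1` box B `&` E) = prob P (f @^-1` box B) * prob P E) ->
  forall A, measurable A ->
    prob P (f @^-1` A `&` E) = prob P (f @^-1` A) * prob P E.
Proof.
move=> mf mE fE A mA.
have mpre C : measurable C -> measurable (f @^-1` C).
  by move=> mC; rewrite -[X in measurable X]setTI; exact: mf.
pose m1 := measure_function_pushforward__canonical__measure_function_Measure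
  (measure_function_mrestr__canonical__measure_function_Measure P mE) mf.
pose m2 := measure_function_mscale__canonical__measure_function_Measure
  (NngNum (prob_ge0 P E)) (measure_function_pushforward__canonical__measure_function_Measure P mf).
have m1E C : m1 C = P (f @^-1` C `&` E) by [].
have m2E C : m2 C = ((prob P E)%:E * P (f @^-1` C))%E by [].
have : m1 A = m2 A.
  apply: tensor_measure_unique => //.
    by rewrite m1E preimage_setT setTI -ge0_fin_numE// fin_num_measure.
  move=> B mB; rewrite m1E m2E.
  have mB' := mpre _ (measurable_box mB).
  by rewrite !probE//; [rewrite fE// mulrC EFinM|exact: measurableI].
rewrite m1E m2E !probE; [|exact: mpre|by apply: measurableI => //; exact: mpre].
by rewrite -EFinM mulrC => -[].
Qed.

End tensor_sigma_algebra.

Section gaussian_noise.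
Variables (R : realType) (k d : nat) (I : finType).
Context dO (Omega : measurableType dO) (P : probability Omega R).
Variable W : I * mindex k d -> {RV P >-> R}.
Hypothesis W_iid : iid_standard_normal W.
Local Notation tensor := (tensor R k d).
Local Notation prob := (prob P).

Definition noise (i : I) (w : Omega) : tensor := [ffun j => W (i, j) w].

Lemma measurable_noise i : measurable_fun [set: Omega] (noise i).
Proof.
apply: measurable_fun_tensor => j.
rewrite (_ : (fun _ => _) = W (i, j)); first exact: measurable_funPT.
by apply/funext => w; rewrite ffunE.
Qed.

Lemma measurable_entry ij (B : set R) : measurable B -> measurable (W ij @^-1` B).
Proof. by move=> mB; rewrite -[X in measurable X]setTI; exact: measurable_funPT. Qed.

Lemma measurable_entries (B : I * mindex k d -> set R) : (forall ij, measurable (B ij)) ->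
  measurable [set w | forall ij, B ij (W ij w)].
Proof.
move=> mB; rewrite (_ : [set _ | _] = \bigcap_(ij in [set: I * mindex k d]) (W ij @^-1` B ij)).
  by apply: fin_bigcap_measurable => // ij _; exact: measurable_entry.
by apply/seteqP; split=> w Bw ij => [_|]; exact: Bw.
Qed.

Lemma prob_entries (B : I * mindex k d -> set R) : (forall ij, measurable (B ij)) ->
  prob [set w | forall ij, B ij (W ij w)] = \prod_ij prob (W ij @^-1` B ij).
Proof.
move=> mB; apply: EFin_inj; rewrite -probE; last exact: measurable_entries.
have [indep _] := W_iid; have := indep [set: _]%SET B mB.
rewrite (_ : [set w | _] = [set w | forall ij, B ij (W ij w)]); last first.
  by apply/seteqP; split=> w Bw ij => [|_]; apply: Bw; rewrite ?finset.in_setT.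
move=> ->; rewrite -prodEFin; apply: eq_big => ij; first by rewrite finset.in_setT.
by rewrite probE//; exact: measurable_entry.
Qed.

Lemma prob_boxes (B : I -> mindex k d -> set R) : (forall i j, measurable (B i j)) ->
  prob [set w | forall i, box (B i) (noise i w)] =
  \prod_i \prod_j prob (W (i, j) @^-1` B i j).
Proof.
move=> mB; rewrite pair_bigA/=.
transitivity (\prod_ij prob (W ij @^-1` B ij.1 ij.2)); last first.
  by apply: eq_bigr => -[].
rewrite -(@prob_entries (fun ij => B ij.1 ij.2))//; congr prob.
apply/seteqP; split=> w Bw.
  by move=> [i j]; have := Bw i j; rewrite ffunE.
by move=> i j; rewrite ffunE; exact: (Bw (i, j)).
Qed.

Lemma prob_box (i : I) (B : mindex k d -> set R) : (forall j, measurable (B j)) ->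
  prob (noise i @^-1` box B) = \prod_j prob (W (i, j) @^-1` B j).
Proof.
move=> mB.
transitivity (prob [set w | forall i', box (fun j => if i' == i then B j else setT)
   (noise i' w)]).
  congr prob; apply/seteqP; split=> w Bw.
    by move=> i' j; case: eqP => // ->; exact: Bw.
  by move=> j; have := Bw i j; rewrite eqxx.
rewrite prob_boxes; last by move=> i' j; case: ifP.
rewrite (bigD1 i)//= eqxx [X in _ * X]big1 ?mulr1// => i' /negbTE ->.
by apply: big1 => j _; rewrite preimage_setT /prob probability_setT.
Qed.

(** From independence of the entries to independence of the tensors: the sets A i
are freed one at a time from being boxes, U being the list of those already
free. *)
Lemma noise_indep (A : I -> set tensor) : (forall i, measurable (A i)) ->
  prob [set w | forall i, A i (noise i w)] = \prod_i prob (noise i @^-1` A i).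
Proof.
have mpre i C : measurable C -> measurable (noise i @^-1` C).
  by move=> mC; rewrite -[X in measurable X]setTI; exact: measurable_noise.
suff gen : forall (U : seq I) (A : I -> set tensor), (forall i, measurable (A i)) ->
   (forall i, i \notin U -> exists2 B : mindex k d -> set R,
      (forall j, measurable (B j)) & A i = box B) ->
   prob [set w | forall i, A i (noise i w)] = \prod_i prob (noise i @^-1` A i).
  by move=> mA; apply: (gen (enum I)) => // i; rewrite mem_enum.
elim=> [|x U IH] {}A mA Abox.
  have /choice [B HB] : forall i, exists B : mindex k d -> set R,
      (forall j, measurable (B j)) /\ A i = box B.
    by move=> i; have [//|B mB AB] := Abox i; exists B.
  have mB i j : measurable (B i j) by case: (HB i).
  have AE i : A i = box (B i) by case: (HB i).
  transitivity (prob [set w | forall i, box (B i) (noise i w)]).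
    by congr prob; apply/seteqP; split=> w /= Aw i; have := Aw i; rewrite AE.
  by rewrite prob_boxes//; apply: eq_bigr => i _; rewrite AE prob_box.
pose upd C i := if i == x then C else A i.
have mupd C : measurable C -> forall i, measurable (upd C i).
  by move=> mC i; rewrite /upd; case: ifP.
have updprob B : (forall j, measurable (B j)) ->
   prob [set w | forall i, upd (box B) i (noise i w)] =
   prob (noise x @^-1` box B) * \prod_(i | i != x) prob (noise i @^-1` A i).
  move=> mB; rewrite IH.
  - rewrite (bigD1 x)//= {1}/upd eqxx; congr (_ * _).
    by apply: eq_bigr => i /negbTE ix; rewrite /upd ix.
  - by apply: mupd; exact: measurable_box.
  - move=> i iU; rewrite /upd; case: eqP => [_|/eqP ix]; first by exists B.
    by apply: Abox; rewrite inE negb_or ix.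
pose E := [set w | forall i, i != x -> A i (noise i w)].
have mE : measurable E.
  rewrite (_ : E = \bigcap_(i in [set i | i != x]) (noise i @^-1` A i))//.
  apply: fin_bigcap_measurable => [|i _]; last exact: mpre.
  exact: finite_finset.
have updE C : [set w | forall i, upd C i (noise i w)] = noise x @^-1` C `&` E.
  apply/seteqP; split=> w /= => [Cw|[Cw Ew] i].
    split; first by have := Cw x; rewrite /upd eqxx.
    by move=> i /negbTE ix; have := Cw i; rewrite /upd ix.
  by rewrite /upd; case: eqP => [->//|/eqP]; exact: Ew.
have probE' : prob E = \prod_(i | i != x) prob (noise i @^-1` A i).
  have := updprob (fun=> setT) (fun=> measurableT); rewrite updE.
  have -> : box (fun=> setT) = [set: tensor] by apply/seteqP; split.
  by rewrite preimage_setT setTI {2}/prob probability_setT/= mul1r.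
transitivity (prob (noise x @^-1` A x `&` E)).
  congr prob; rewrite -updE; apply/seteqP; split=> w Aw i; have := Aw i; rewrite /upd;
  by case: eqP => // ->.
rewrite (indep_event_extend (measurable_noise x) mE)// ?probE' ?[RHS](bigD1 x)//=.
by move=> B mB; rewrite -updE updprob// probE'.
Qed.

Definition set_entry (j : mindex k d) (y : tensor) (z : R) : tensor :=
  [ffun j' => if j' == j then z else y j'].

Lemma measurable_set_entry j :
  measurable_fun [set: tensor * measurableTypeR R] (fun yz => set_entry j yz.1 yz.2).
Proof.
apply: measurable_fun_tensor => j'.
have [->|j'j] := eqVneq j' j.
  rewrite (_ : (fun _ => _) = snd); first exact: measurable_snd.
  by apply/funext => yz; rewrite ffunE eqxx.
rewrite (_ : (fun _ => _) = (fun X : tensor => X j') \o fst).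
  by apply: measurableT_comp => //; exact: measurable_coordinate.
by apply/funext => yz; rewrite ffunE (negbTE j'j).
Qed.

(** The noise with entry j erased: a tensor that depends on the other entries only,
so that the full noise is a function of the independent pair
(other_noise, entry j). *)
Definition other_noise i j (w : Omega) : tensor := set_entry j (noise i w) 0.

Lemma measurable_other_noise i j : measurable_fun [set: Omega] (other_noise i j).
Proof.
rewrite (_ : other_noise i j =
  (fun yz => set_entry j yz.1 yz.2) \o (fun w => (noise i w, 0 : measurableTypeR R)))//.
apply: measurableT_comp; first exact: measurable_set_entry.
by apply: measurable_fun_pair => //; exact: measurable_noise.
Qed.

Lemma other_noise_indep i j (B : set R) (A : set tensor) : measurable B -> measurable A ->
  prob (other_noise i j @^-1` A `&` W (i, j) @^-1` B) =
  prob (other_noise i j @^-1` A) * prob (W (i, j) @^-1` B).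
Proof.
move=> mB; apply: indep_event_extend.
- exact: measurable_other_noise.
- exact: measurable_entry.
move=> C mC; have [C0|C0] := pselect (C j 0); last first.
  have -> : other_noise i j @^-1` box C = set0.
    apply/seteqP; split=> // w /(_ j); rewrite ffunE eqxx; exact: C0.
  by rewrite set0I /prob measure0 mul0r.
pose D (B' : set R) ij := if ij == (i, j) then B' else
   if ij.1 == i then C ij.2 else setT.
have mD B' : measurable B' -> forall ij, measurable (D B' ij).
  by move=> mB' ij; rewrite /D; case: ifP => // _; case: ifP.
have DE B' : other_noise i j @^-1` box C `&` W (i, j) @^-1` B' =
    [set w | forall ij, D B' ij (W ij w)].
  apply/seteqP; split=> w /=.
    move=> [Cw Bw] [i' j']; rewrite /D; case: eqP => [->//|/eqP ij].
    case: eqP => //= i'i; have := Cw j'; rewrite !ffunE.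
    by move: ij; rewrite -{1}i'i xpair_eqE i'i eqxx/= => /negbTE ->.
  move=> Dw; split; last by have := Dw (i, j); rewrite /D eqxx.
  move=> j'; rewrite !ffunE; case: eqP => [->//|/eqP j'j].
  by have := Dw (i, j'); rewrite /D xpair_eqE (negbTE j'j) andbF/= eqxx.
have prodD B' : measurable B' -> prob (other_noise i j @^-1` box C `&` W (i, j) @^-1` B') =
    prob (W (i, j) @^-1` B') *
    \prod_(ij | ij != (i, j)) prob (W ij @^-1` (if ij.1 == i then C ij.2 else setT)).
  move=> mB'; rewrite DE (prob_entries (mD _ mB')).
  rewrite (bigD1 (i, j))//= {1}/D eqxx; congr (_ * _).
  by apply: eq_bigr => ij /negbTE ijN; rewrite /D ijN.
have := prodD setT measurableT; rewrite preimage_setT setIT {2}/prob probability_setT/= mul1r.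
by move=> ->; rewrite prodD// mulrC.
Qed.

Lemma noiseE i j w : noise i w = set_entry j (other_noise i j w) (W (i, j) w).
Proof. by apply/ffunP => j'; rewrite !ffunE; case: eqP => // ->. Qed.


Lemma entry_law ij (B : set R) : measurable B -> P (W ij @^-1` B) = normal_prob 0 1 B.
Proof. by move=> mB; have [_ ->] := W_iid. Qed.

Definition spiked_noise (m : R) (j : mindex k d) (i : I) (w : Omega) : tensor :=
  set_entry j (other_noise i j w) (W (i, j) w + m).

Lemma measurable_spiked_noise m j i : measurable_fun [set: Omega] (spiked_noise m j i).
Proof.
rewrite (_ : spiked_noise m j i =
  (fun yz => set_entry j yz.1 yz.2) \o (fun w => (other_noise i j w, W (i, j) w + m : measurableTypeR R)))//.
apply: measurableT_comp; first exact: measurable_set_entry.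
apply: measurable_fun_pair; first exact: measurable_other_noise.
by apply: measurable_funD => //; exact: measurable_funPT.
Qed.

Lemma spiked_noiseE m i j w : spiked_noise m j i w =
  [ffun j' => noise i w j' + (j' == j)%:R * m].
Proof.
apply/ffunP => j'; rewrite !ffunE; case: eqP => [->|]; first by rewrite mul1r.
by rewrite mul0r addr0.
Qed.

HB.instance Definition _ i j := isMeasurableFun.Build _ _ _ _
  (other_noise i j) (measurable_other_noise i j).

(** A spike changes the law of entry j only; the law of the pair formed by the
other entries and entry j is therefore a product measure with a shifted second
factor. *)
Lemma prob_spiked_noise m i j (A : set tensor) : measurable A ->
  P (spiked_noise m j i @^-1` A) =
  (distribution P (other_noise i j) \x normal_prob m 1)%E
     [set yz : tensor * measurableTypeR R | A (set_entry j yz.1 yz.2)].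
Proof.
move=> mA.
have mset : measurable [set yz : tensor * measurableTypeR R | A (set_entry j yz.1 yz.2)].
  by rewrite -[X in measurable X]setTI; exact: measurable_set_entry.
have mpair : measurable_fun [set: Omega] (fun w => (other_noise i j w, W (i, j) w + m : measurableTypeR R)).
  apply: measurable_fun_pair; first exact: measurable_other_noise.
  by apply: measurable_funD => //; exact: measurable_funPT.
pose m' := measure_function_pushforward__canonical__measure_function_Measure P mpair.
rewrite -[LHS]/(m' [set yz : tensor * measurableTypeR R | A (set_entry j yz.1 yz.2)]).
apply/esym.
apply: (@product_measure_unique _ _ tensor (measurableTypeR R) R
  (distribution P (other_noise i j)) (normal_prob m 1) m') => // B C mB mC.
have mC' : measurable ((fun x => x + m) @^-1` C).
  by rewrite -[X in measurable X]setTI; exact: measurable_addr.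
have mY : measurable (other_noise i j @^-1` B).
  by rewrite -[X in measurable X]setTI; exact: measurable_other_noise.
have mW := measurable_entry (i, j) mC'.
rewrite [LHS](_ : _ = P (other_noise i j @^-1` B `&` W (i, j) @^-1` ((fun x => x + m) @^-1` C)))//.
rewrite probE; last exact: measurableI.
by rewrite other_noise_indep// EFinM -!probE// entry_law// normal_prob_addr.
Qed.

Lemma spiked_noise0 i j : spiked_noise 0 j i = noise i.
Proof. by apply/funext => w; rewrite /spiked_noise addr0 -noiseE. Qed.

(** The pointwise comparison of the one-dimensional densities is applied on every
line parallel to the axis j and integrated over the other entries.  As A lies
over B, only points of B are met. *)
Lemma prob_spiked_noise_ge m i j (c : R) (B : set R) (A : set tensor) :
  measurable A -> measurable B -> 0 <= c ->
  (forall x, B x -> c * normal_pdf 0 1 x <= normal_pdf m 1 x) ->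
  A `<=` [set X | B (X j)] ->
  c * prob (noise i @^-1` A) <= prob (spiked_noise m j i @^-1` A).
Proof.
move=> mA mB c0 Bc AB.
have mset : measurable [set yz : tensor * measurableTypeR R | A (set_entry j yz.1 yz.2)].
  by rewrite -[X in measurable X]setTI; exact: measurable_set_entry.
rewrite -lee_fin EFinM -!probE; last 2 first.
- by rewrite -[X in measurable X]setTI; exact: (measurable_spiked_noise m j i measurableT mA).
- by rewrite -[X in measurable X]setTI; exact: (measurable_noise i measurableT mA).
rewrite -(spiked_noise0 i j) !prob_spiked_noise// /product_measure1.
rewrite -ge0_integralZl//; last exact: (measurable_fun_xsection (normal_prob 0 1) mset).
apply: ge0_le_integral => //.
- by move=> y _; rewrite mule_ge0.
- by apply: measurable_funeM; exact: (measurable_fun_xsection (normal_prob _ 1) mset).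
- exact: (measurable_fun_xsection (normal_prob _ 1) mset).
move=> y _; apply: le_normal_prob => //; first exact: measurable_xsection.
move=> x; rewrite /xsection/= inE => Ax; apply: Bc.
by have := AB _ Ax; rewrite /= ffunE eqxx.
Qed.

End gaussian_noise.

(** * Finite description of a memory bounded algorithm *)

Section streaming_algorithm.
Context dX (X : measurableType dX) (Y : Type) (N T s : nat).
Variable A : memory_algorithm X Y N T s.
Local Notation S := (s.-tuple bool).
Local Notation F := {ffun 'I_T * S -> S}.

Definition response (i : 'I_N) (x : X) : F :=
  [ffun tm => memory_update A tm.1 i tm.2 x].

(** Row-major order: pass t runs through all the samples before pass t + 1. *)
Definition steps : seq ('I_T * 'I_N) := [seq (t, i) | t <- enum 'I_T, i <- enum 'I_N].

Lemma memory_outputE (x : 'I_N -> X) : memory_output A x =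
  memory_estimator A (final_state steps [tuple of nseq s false] (fun i => response i (x i))).
Proof.
rewrite /memory_output /steps; congr memory_estimator.
have final_cat u v m z : @final_state 'I_T 'I_N S (u ++ v) m z =
    final_state v (final_state u m z) z.
  by elim: u m => //= -[t i] u IH m; rewrite IH.
have passE m t : foldl (fun m' i => memory_update A t i m' (x i)) m (enum 'I_N) =
    final_state [seq (t, i) | i <- enum 'I_N] m (fun i => response i (x i)).
  by elim: (enum 'I_N) m => //= i is_ IH m; rewrite IH ffunE.
elim: (enum 'I_T) [tuple of nseq s false] => //= t ts IH m.
by rewrite final_cat passE IH.
Qed.

Lemma visits_steps (i : 'I_N) : count_mem i (map snd steps) = T.
Proof.
rewrite /steps -[RHS]size_enum_ord; elim: (enum 'I_T) => //= t ts IH.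
rewrite map_cat count_cat IH -map_comp map_id_in// count_uniq_mem ?enum_uniq//.
by rewrite mem_enum.
Qed.

Lemma measurable_tuple1 (u : S) : measurable [set u].
Proof.
rewrite (_ : [set u] = \bigcap_(l in [set: 'I_s]) ((@tnth _ _ ^~ l) @^-1` [set tnth u l])).
  apply: fin_bigcap_measurable => // l _.
  by rewrite -[X in measurable X]setTI; exact: measurable_tnth.
apply/seteqP; split=> v /=; first by move=> ->.
by move=> uv; apply: eq_from_tnth => l; exact: uv.
Qed.

Lemma measurable_response i (f : F) : measurable (response i @^-1` [set f]).
Proof.
rewrite (_ : _ @^-1` _ = \bigcap_(tm in [set: 'I_T * S])
   (memory_update A tm.1 i tm.2 @^-1` [set f tm])).
  apply: fin_bigcap_measurable => [|tm _]; first exact: finite_finset.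
  rewrite -[X in measurable X]setTI.
  exact: (memory_update_measurable A tm.1 i tm.2 measurableT (measurable_tuple1 _)).
apply/seteqP; split=> x /=; first by move=> <- tm _; rewrite /= ffunE.
by move=> xf; apply/ffunP => tm; rewrite ffunE; exact: xf.
Qed.

End streaming_algorithm.

(** * The spiked experiment in a fixed dimension *)

Section spike_prior.
Variables (R : realType) (k d : nat).
Local Notation tensor := (tensor R k d).

(** A basis tensor, scaled to the norm required of a parameter; each factor is a
basis vector of norm sqrt d. *)
Definition spike (j : mindex k d) : tensor :=
  tensor_prod (fun i => [ffun l => (l == j i)%:R * Num.sqrt d%:R]).

Lemma spike_param j : ATPCA_param (spike j).
Proof.
exists (fun i => [ffun l => (l == j i)%:R * Num.sqrt d%:R]) => // i.
rewrite /enorm /inner (bigD1 (j i))//= big1 => [|l /negbTE lj].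
  by rewrite !ffunE eqxx mul1r addr0 -expr2 sqr_sqrtr.
by rewrite ffunE lj !mul0r.
Qed.

Lemma spikeE j j' : spike j j' = (j' == j)%:R * Num.sqrt (d%:R ^+ k).
Proof.
rewrite ffunE; under eq_bigr do rewrite ffunE.
rewrite big_split/= prodr_const card_ord.
have -> : Num.sqrt d%:R ^+ k = Num.sqrt (d%:R ^+ k : R).
  elim: k => [|k' IH]; first by rewrite !expr0 sqrtr1.
  by rewrite !exprS sqrtrM// IH.
congr (_ * _); have [->|/eqP j'j] := eqVneq j' j.
  by rewrite big1// => i _; rewrite eqxx.
have [i ji] : exists i, j' i != j i.
  apply: contrapT => /forallNP jj; apply: j'j; apply/ffunP => i.
  by have /negP := jj i; rewrite negbK => /eqP.
by rewrite (bigD1 i)//= (negbTE ji) mul0r.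
Qed.

Lemma sum_sq_cosine_spike (u : tensor) : (0 < d)%N ->
  \sum_j sq_cosine (spike j) u <= 1.
Proof.
move=> d0; have D0 : 0 < d%:R ^+ k :> R by rewrite exprn_gt0// ltr0n.
have inner_spike j v : inner (spike j) v = Num.sqrt (d%:R ^+ k) * v j.
  rewrite /inner (bigD1 j)//= big1 => [|j' /negbTE j'j].
    by rewrite spikeE eqxx mul1r addr0.
  by rewrite spikeE j'j !mul0r.
have inner0 (v : tensor) : 0 <= inner v v.
  by apply: sumr_ge0 => j _; rewrite -expr2 sqr_ge0.
have cosE j : sq_cosine (spike j) u = u j ^+ 2 / inner u u.
  rewrite /sq_cosine /enorm !sqr_sqrtr// !inner_spike spikeE eqxx mul1r.
  rewrite real_normK ?num_real// exprMn -expr2 sqr_sqrtr ?ltW//.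
  by rewrite -mulf_div divff ?mul1r// gt_eqF.
under eq_bigr do rewrite cosE.
rewrite -mulr_suml (_ : \sum_j u j ^+ 2 = inner u u); last first.
  by apply: eq_bigr => j _; rewrite expr2.
by have [->|?] := eqVneq (inner u u) 0; [rewrite mul0r|rewrite divff].
Qed.

Lemma card_mindex : #|{: mindex k d}| = (d ^ k)%N.
Proof. by rewrite card_ffun !card_ord. Qed.

(** Markov's inequality for the uniform law on the spikes. *)
Lemma card_large_cosine (t : R) (u : tensor) : (0 < d)%N -> t != 0 ->
  \sum_(j : mindex k d) ((t ^+ 2 / d%:R ^+ k <= sq_cosine (spike j) u)%R)%:R <= d%:R ^+ k / t ^+ 2.
Proof.
move=> d0 t0; have t2 : 0 < t ^+ 2 by rewrite exprn_even_gt0.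
have D0 : 0 < d%:R ^+ k :> R by rewrite exprn_gt0// ltr0n.
have c0 : 0 < t ^+ 2 / d%:R ^+ k by rewrite divr_gt0.
rewrite -(ler_pM2l c0) mulr_sumr.
rewrite [leRHS](_ : _ = 1); last by field; rewrite t0 gt_eqF.
apply: le_trans (sum_sq_cosine_spike u d0); apply: ler_sum => j _.
case: (leP (t ^+ 2 / _)) => [|_]; first by rewrite mulr1.
by rewrite mulr0 /sq_cosine divr_ge0 ?sqr_ge0// mulr_ge0 ?sqr_ge0.
Qed.

End spike_prior.

Section spiked_experiment.
Variables (R : realType) (k d N T s : nat).
Context dO (Omega : measurableType dO) (P : probability Omega R).
Variable W : 'I_N * mindex k d -> {RV P >-> R}.
Hypothesis W_iid : iid_standard_normal W.
Variable A : memory_algorithm (tensor R k d) (tensor R k d) N T s.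
Variables (m : R) (n M : nat).
Hypothesis d_gt0 : (0 < d)%N.
Hypothesis n_gt0 : (0 < n)%N.
Hypothesis M_gt0 : (0 < M)%N.
Local Notation tensor := (tensor R k d).
Local Notation S := (s.-tuple bool).
Local Notation F := {ffun 'I_T * S -> S}.
Local Notation J := (mindex k d).
Local Notation Q := 'I_(n * M).+1.
Local Notation prob := (prob P).
Local Notation delta := (lost_mass m n M).

Definition bins (X : tensor) : {ffun J -> Q} := [ffun j => lik_bin m n M (X j)].

(** All that matters about a sample, as a point of a finite type: its action on the
memory, and the truncated likelihood ratios of its entries against every
spike. *)
Definition digest (i : 'I_N) (X : tensor) : F * {ffun J -> Q} := (response A i X, bins X).

Lemma measurable_bins b : measurable (bins @^-1` [set b]).
Proof.
rewrite (_ : _ @^-1` _ = box (fun j => lik_bin m n M @^-1` [set b j])).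
  by apply: measurable_box => j; exact: measurable_lik_bin.
apply/seteqP; split=> X /=; first by move=> <- j; rewrite /= ffunE.
by move=> Xb; apply/ffunP => j; rewrite ffunE; exact: Xb.
Qed.

Lemma measurable_digest i o : measurable (digest i @^-1` [set o]).
Proof.
rewrite (_ : _ @^-1` _ = response A i @^-1` [set o.1] `&` bins @^-1` [set o.2]).
  by apply: measurableI; [exact: measurable_response|exact: measurable_bins].
by apply/seteqP; split=> X /= => [<-//|[Xo Xo2]]; rewrite /digest Xo Xo2 -surjective_pairing.
Qed.

Lemma measurable_noise_preimage i C : measurable C -> measurable (noise W i @^-1` C).
Proof. by move=> mC; rewrite -[X in measurable X]setTI; exact: (measurable_noise W i measurableT mC). Qed.

Lemma measurable_spiked_preimage i j C : measurable C -> measurable (spiked_noise W m j i @^-1` C).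
Proof.
by move=> mC; rewrite -[X in measurable X]setTI; exact: (measurable_spiked_noise W m j i measurableT mC).
Qed.

Definition null_digest i o := prob (noise W i @^-1` (digest i @^-1` [set o])).
Definition null_response i x := prob (noise W i @^-1` (response A i @^-1` [set x])).
Definition alt_response i j x := prob (spiked_noise W m j i @^-1` (response A i @^-1` [set x])).
Definition centred_level (r : Q) : R := level R r - (1 - delta).
(** The signed mass of the response x after weighting by the centred truncated
likelihood ratio of spike j. *)
Definition correlation i j x : R :=
  \sum_(o | o.1 == x) null_digest i o * centred_level (o.2 j).

Lemma prob_digest i (C : pred (F * {ffun J -> Q})) :
  prob (noise W i @^-1` [set X | C (digest i X)]) = \sum_(o | C o) null_digest i o.
Proof.
rewrite -(@prob_fibers _ _ _ P _ (digest i \o noise W i))// => o.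
exact: (measurable_noise_preimage i (measurable_digest i o)).
Qed.

Lemma null_responseE i (C : pred F) :
  \sum_(x | C x) null_response i x = \sum_(o | C o.1) null_digest i o.
Proof.
rewrite -(prob_digest i (fun o => C o.1)).
rewrite -(@prob_fibers _ _ _ P _ (response A i \o noise W i))// => x.
exact: (measurable_noise_preimage i (measurable_response A i x)).
Qed.

Lemma null_response1E i x : null_response i x = \sum_(o | o.1 == x) null_digest i o.
Proof. by rewrite -(null_responseE i (pred1 x)) big_pred1_eq. Qed.

Lemma correlationE i j (C : pred F) :
  \sum_(x | C x) correlation i j x = \sum_(o | C o.1) null_digest i o * centred_level (o.2 j).
Proof.
rewrite /correlation (exchange_big_dep (fun o => C o.1))/=; last first.
  by move=> x o Cx /eqP ->.
apply: eq_bigr => o Co; rewrite (big_pred1 o.1)// => x.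
by rewrite eq_sym andb_idl// => /eqP ->.
Qed.

Lemma digest_indep i (g : J -> Q -> R) :
  \sum_o null_digest i o * \prod_j g j (o.2 j) =
  \prod_j \sum_r lik_bin_prob m 0 r * g j r.
Proof.
rewrite bigA_distr_bigA (partition_big snd predT)//=; apply: eq_bigr => b _.
rewrite big_split/= -[X in X * _](_ : \sum_(o | o.2 == b) null_digest i o = _).
  by rewrite mulr_suml; apply: eq_bigr => o /eqP ->.
rewrite -(prob_digest i (fun o => o.2 == b)).
transitivity (prob (noise W i @^-1` box (fun j => lik_bin m n M @^-1` [set b j]))).
  congr prob; apply/seteqP; split=> w /=.
    by move=> /eqP <- j; rewrite /= !ffunE.
  by move=> wb; apply/eqP/ffunP => j; rewrite ffunE; exact: wb.
rewrite prob_box//; last by move=> j; exact: measurable_lik_bin.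
by apply: eq_bigr => j _; congr fine; apply: entry_law => //; exact: measurable_lik_bin.
Qed.

Lemma centred_level_mean0 : \sum_r lik_bin_prob m 0 r * centred_level r = 0.
Proof.
under eq_bigr do rewrite mulrBr.
by rewrite sumrB -mulr_suml lik_bin_prob_sum1 mul1r /lost_mass subKr subrr.
Qed.

Lemma correlation_sum0 i j : \sum_x correlation i j x = 0.
Proof.
rewrite (correlationE i j predT)/=.
transitivity (\sum_o null_digest i o *
    \prod_j' (if j' == j then centred_level (o.2 j') else 1)).
  apply: eq_bigr => o _; rewrite (bigD1 j)//= eqxx big1 ?mulr1// => j' /negbTE ->//.
rewrite (digest_indep i (fun j' r => if j' == j then centred_level r else 1)).
by rewrite (bigD1 j)//= eqxx centred_level_mean0 mul0r.
Qed.

Lemma correlation_level_one i (C : pred F) :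
  \sum_j (\sum_(x | C x) correlation i j x) ^+ 2 <=
  (\sum_(x | C x) null_response i x) ^+ 2 *
    (16 * M%:R ^+ 2 * - ln (\sum_(x | C x) null_response i x)).
Proof.
under eq_bigr do rewrite correlationE.
rewrite null_responseE.
apply: (@level_one_inequality R J Q _ (null_digest i) (fun j o => o.2 j)
  (lik_bin_prob m 0) centred_level M%:R _ (digest_indep i)).
- by move=> o; exact: prob_ge0.
- by move=> r; exact: lik_bin_prob_ge0.
- exact: lik_bin_prob_sum1.
- exact: centred_level_mean0.
- by rewrite ltr0n.
move=> r; have := level_ge0 R r; have := level_leM R n_gt0 r.
have := lost_mass_le1 m n M; have := lost_mass_ge0 m M n_gt0.
have M1 : 1 <= M%:R :> R by rewrite ler1n.
by rewrite /centred_level => *; rewrite ler_norml; apply/andP; split; lra.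
Qed.

Lemma truncated_likE i j x : (1 - delta) * null_response i x + correlation i j x =
  \sum_(o | o.1 == x) null_digest i o * level R (o.2 j).
Proof.
rewrite null_response1E /correlation mulr_sumr -big_split/=; apply: eq_bigr => o _.
by rewrite /centred_level; ring.
Qed.

(** On the cells where entry j lies in a given bin the truncated likelihood ratio
is constant, so the comparison of a spiked with an unspiked sample applies cell
by cell. *)
Lemma truncated_lik_le i j x :
  (1 - delta) * null_response i x + correlation i j x <= alt_response i j x.
Proof.
rewrite truncated_likE (partition_big (fun o : F * {ffun J -> Q} => o.2 j) xpredT)//=.
have mresp : measurable (response A i @^-1` [set x]) by exact: measurable_response.
pose cell (r : Q) := [set X : tensor | (response A i X == x) && (lik_bin m n M (X j) == r)].
have cellE r : cell r = response A i @^-1` [set x] `&` [set X | (lik_bin m n M @^-1` [set r]) (X j)].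
  apply/seteqP; split=> X /=; first by move=> /andP[/eqP ? /eqP ?].
  by move=> [? ?]; apply/andP; split; apply/eqP.
have mcell r : measurable (cell r).
  by rewrite cellE; apply: measurableI => //; apply: measurable_cylinder; exact: measurable_lik_bin.
have -> : alt_response i j x = \sum_r prob (spiked_noise W m j i @^-1` cell r).
  pose q w := (response A i (spiked_noise W m j i w), lik_bin m n M (spiked_noise W m j i w j)).
  have qE xr : q @^-1` [set xr] = spiked_noise W m j i @^-1`
      (response A i @^-1` [set xr.1] `&` [set X | (lik_bin m n M @^-1` [set xr.2]) (X j)]).
    by case: xr => x' r; apply/seteqP; split=> w; rewrite /q/=; by move=> [-> ->].
  have mq xr : measurable (q @^-1` [set xr]).
    rewrite qE; apply: measurable_spiked_preimage; apply: measurableI.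
      exact: measurable_response.
    by apply: measurable_cylinder; exact: measurable_lik_bin.
  transitivity (prob [set w | (q w).1 == x]).
    congr prob; apply/seteqP; split=> w /=; first by move=> ->.
    by move/eqP.
  rewrite (prob_fibers P mq (fun xr => xr.1 == x)).
  rewrite (partition_big (fun xr : F * Q => xr.2) xpredT)//=; apply: eq_bigr => r _.
  by rewrite (big_pred1 (x, r)) ?qE ?cellE// => xr; rewrite -xpair_eqE -surjective_pairing.
apply: ler_sum => r _.
have -> : \sum_(o : F * {ffun J -> Q} | (o.1 == x) && (o.2 j == r)) null_digest i o * level R (o.2 j) =
    level R r * prob (noise W i @^-1` cell r).
  have -> : cell r = [set X | (fun o : F * {ffun J -> Q} => (o.1 == x) && (o.2 j == r)) (digest i X)].
    by apply/seteqP; split=> X /=; rewrite ffunE.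
  rewrite (prob_digest i (fun o : F * {ffun J -> Q} => (o.1 == x) && (o.2 j == r))) mulr_sumr.
  by apply: eq_bigr => o /andP[_ /eqP->]; rewrite mulrC.
apply: (@prob_spiked_noise_ge _ _ _ _ _ _ _ _ W_iid m i j _ (lik_bin m n M @^-1` [set r])) => //.
- exact: measurable_lik_bin.
- exact: level_ge0.
- move=> y <-; rewrite (pdf_lik_ratio m) ler_wpM2r ?normal_pdf_ge0//.
  exact: level_le.
- by rewrite cellE => X [].
Qed.

Lemma sum_null_response i : \sum_x null_response i x = 1.
Proof.
apply: (prob_fibers1 P (q := response A i \o noise W i)) => x.
exact: (measurable_noise_preimage i (measurable_response A i x)).
Qed.

Lemma sum_alt_response i j : \sum_x alt_response i j x = 1.
Proof.
apply: (prob_fibers1 P (q := response A i \o spiked_noise W m j i)) => x.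
exact: (measurable_spiked_preimage i j (measurable_response A i x)).
Qed.

Definition responses j (w : Omega) : {ffun 'I_N -> F} :=
  [ffun i => response A i (spiked_noise W m j i w)].

Let spiked_cell j i x := [set X : tensor |
  response A i [ffun j' => X j' + (j' == j)%:R * m] = x].

Let measurable_spiked_cell j i x : measurable (spiked_cell j i x).
Proof.
have mshift : measurable_fun [set: tensor]
    (fun X => [ffun j' => X j' + (j' == j)%:R * m] : tensor).
  apply: measurable_fun_tensor => j'.
  under eq_fun do rewrite ffunE.
  by apply: measurable_funD => //; exact: measurable_coordinate.
rewrite -[X in measurable X]setTI.
exact: (mshift measurableT _ (measurable_response A i x)).
Qed.

Let responses_fiber j x : responses j @^-1` [set x] =
  [set w | forall i, spiked_cell j i (x i) (noise W i w)].
Proof.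
apply/seteqP; split=> w /=.
  by move=> <- i; rewrite /spiked_cell/= ffunE spiked_noiseE.
by move=> wx; apply/ffunP => i; rewrite ffunE spiked_noiseE; exact: wx.
Qed.

Lemma measurable_responses j x : measurable (responses j @^-1` [set x]).
Proof.
rewrite responses_fiber (_ : [set w | _] =
    \bigcap_(i in [set: 'I_N]) (noise W i @^-1` spiked_cell j i (x i))).
  apply: fin_bigcap_measurable => // i _.
  exact: (measurable_noise_preimage i (measurable_spiked_cell j i (x i))).
by apply/seteqP; split=> w wx i => [_|]; exact: wx.
Qed.

Definition end_state (x : {ffun 'I_N -> F}) : S :=
  final_state (steps N T) [tuple of nseq s false] x.

Lemma prob_end_state j (E : pred S) : prob [set w | E (end_state (responses j w))] =
  \sum_(x : {ffun 'I_N -> F}) (E (end_state x))%:R * \prod_i alt_response i j (x i).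
Proof.
rewrite (prob_fibers P (measurable_responses j) (fun x => E (end_state x))).
rewrite big_mkcond; apply: eq_bigr => x _; case: ifP => _; last by rewrite mul0r.
rewrite mul1r responses_fiber.
rewrite (noise_indep W_iid (A := fun i => spiked_cell j i (x i)))//.
apply: eq_bigr => i _; congr prob; apply/seteqP; split=> w;
  by rewrite /spiked_cell/= spiked_noiseE.
Qed.

Lemma spiked_outputE j w : memory_output A (fun i => spiked_noise W m j i w) =
  memory_estimator A (end_state (responses j w)).
Proof.
rewrite memory_outputE /end_state; congr (memory_estimator _ (final_state _ _ _)).
by apply: funext => i; rewrite ffunE.
Qed.

Theorem sum_alternatives_le (E : J -> pred S) (kappa : R) : 0 < kappa ->
  \sum_j prob [set w | E j (end_state (responses j w))] <=
  \sum_j \sum_(x : {ffun 'I_N -> F}) (E j (end_state x))%:R *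
     \prod_i null_response i (x i) +
  ((d ^ k)%:R * (N%:R * delta + 8 * N%:R * delta ^+ 2 + kappa / 2) +
   ((2 * kappa)^-1 + 8) * (N%:R * (16 * M%:R ^+ 2 * (T%:R * (s%:R * ln 2))))).
Proof.
move=> kappa0; under eq_bigr do rewrite prob_end_state.
have := @alternatives_le_null R 'I_T 'I_N J S (steps N T) [tuple of nseq s false]
  null_response (fun i j => correlation i j) (fun i j => alt_response i j)
  T (16 * M%:R ^+ 2) delta kappa (@visits_steps N T) _ sum_null_response
  _ _ truncated_lik_le sum_alt_response _ _ kappa0 correlation_level_one E.
have lnS : ln #|{: S}|%:R = s%:R * ln 2 :> R.
  by rewrite card_tuple card_bool natrX lnXn// mulr_natl.
rewrite card_mindex card_ord lnS; apply.
- by move=> i x; exact: prob_ge0.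
- by move=> i j; exact: correlation_sum0.
- move=> i j x; rewrite truncated_likE; apply: sumr_ge0 => o _.
  by rewrite mulr_ge0 ?prob_ge0 ?level_ge0.
- by rewrite mulr_ge0 ?sqr_ge0.
- exact: lost_mass_ge0.
Qed.

(** The probability of success, averaged over the spikes, is at most 1 / t ^ 2 for
pure noise plus the loss of [sum_alternatives_le]; some spike does no better
than the average. *)
Theorem exists_spike_le (t kappa : R) : t != 0 -> 0 < kappa ->
  exists j, (P [set w | (t ^+ 2 / d%:R ^+ k <= sq_cosine (spike R j)
      (memory_output A (fun i => spiked_noise W m j i w)))%R] <=
    ((t ^+ 2)^-1 + (N%:R * delta + 8 * N%:R * delta ^+ 2 + kappa / 2 +
     ((2 * kappa)^-1 + 8) * (N%:R * (16 * M%:R ^+ 2 * (T%:R * (s%:R * ln 2)))) /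
     d%:R ^+ k))%:E)%E.
Proof.
move=> t0 kappa0.
have D0 : 0 < d%:R ^+ k :> R by rewrite exprn_gt0// ltr0n.
pose E j (u : S) := t ^+ 2 / d%:R ^+ k <= sq_cosine (spike R j) (memory_estimator A u).
set bound := (X in (X%:E)%E).
have avg : \sum_(j : J) prob [set w | E j (end_state (responses j w))] <= \sum_(j : J) bound.
  rewrite sumr_const card_mindex -[leRHS]mulr_natl natrX.
  apply: (le_trans (sum_alternatives_le E kappa0)).
  rewrite [leRHS](_ : _ = d%:R ^+ k / t ^+ 2 + (d%:R ^+ k * (N%:R * delta +
      8 * N%:R * delta ^+ 2 + kappa / 2) + ((2 * kappa)^-1 + 8) *
      (N%:R * (16 * M%:R ^+ 2 * (T%:R * (s%:R * ln 2)))))); last first.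
    by rewrite /bound; field; rewrite t0 !gt_eqF.
  rewrite natrX lerD2r exchange_big/=.
  under eq_bigr do rewrite -mulr_suml.
  apply: (@le_trans _ _ (\sum_(x : {ffun 'I_N -> F}) d%:R ^+ k / t ^+ 2 *
      \prod_i null_response i (x i))).
    apply: ler_sum => x _; apply: ler_wpM2r; last exact: card_large_cosine.
    by apply: prodr_ge0 => i _; exact: prob_ge0.
  rewrite -mulr_sumr -bigA_distr_bigA/= big1 ?mulr1// => i _; exact: sum_null_response.
have [j Hj] : exists j, prob [set w | E j (end_state (responses j w))] <= bound.
  apply: contrapT => /forallNP Hj; move: avg; apply/negP; rewrite -ltNge.
  have j0 : J by exact: [ffun=> Ordinal d_gt0].
  apply: ltr_sum => [|j _]; first by apply/hasP; exists j0 => //; rewrite mem_index_enum.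
  by rewrite ltNge; apply/negP; exact: Hj.
exists j; under eq_fun do rewrite spiked_outputE.
rewrite probE ?lee_fin//.
exact: (measurable_fibers (measurable_responses j) (fun x => E j (end_state x))).
Qed.

End spiked_experiment.

(** * Letting the dimension grow *)

Section asymptotics.
Variable R : realType.

Lemma limn_esup_le_near (u : nat -> \bar R) (l : \bar R) :
  (\forall d \near \oo, (u d <= l)%E) -> (limn_esup u <= l)%E.
Proof.
move=> ul; apply: (@le_trans _ _ (ereal_sup (u @` [set d | (u d <= l)%E]))).
  by apply: ereal_inf_lbound; exists [set d | (u d <= l)%E].
by apply: ge_ereal_sup => _ [d ? <-].
Qed.

(** The extended quotient in [asymp_le] is the real one as soon as the denominator
is positive; at d = 0 it may vanish. *)
Lemma asymp_le_bound (a b : nat -> R) : (forall d, (0 < d)%N -> 0 < b d) ->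
  asymp_le a b -> exists2 C, 0 < C & \forall d \near \oo, a d <= C * b d.
Proof.
move=> b0 /ereal_inf_lt[_ [D Doo <-] supD].
have [C C0 supC] : exists2 C : R, 0 < C &
    (ereal_sup ((fun d => (a d)%:E / (b d)%:E) @` D) <= C%:E)%E.
  move: supD; case: ereal_sup => [r _| |_]; last 2 first.
  - by rewrite ltxx.
  - by exists 1 => //; rewrite leNye.
  by exists (`|r| + 1); [rewrite ltr_wpDl|rewrite lee_fin (le_trans (ler_norm r))// lerDl].
exists C => //; near=> d.
have d0 : (0 < d)%N by near: d; exact: nbhs_infty_gt.
have Dd : D d by near: d.
have := ereal_sup_ubound (ex_intro2 _ _ d Dd erefl : ((fun d => (a d)%:E / (b d)%:E)%E @` D) _).
move=> /le_trans/(_ supC); rewrite inver gt_eqF ?b0// -EFinM lee_fin.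
by rewrite ler_pdivrMr ?b0.
Unshelve. all: by end_near. Qed.

Lemma powR_small (C a e : R) : a < 0 -> 0 < e ->
  \forall d \near \oo, C * d%:R `^ a <= e.
Proof.
move=> a0 e0; pose y := (`|C| + 1) / e.
have y0 : 0 < y by rewrite divr_gt0// ltr_wpDl.
near=> d.
have d0 : 0 < d%:R :> R by rewrite ltr0n; near: d; exact: nbhs_infty_gt.
have yd : y `^ (- a)^-1 <= d%:R by near: d; exact: nbhs_infty_ger.
have : y <= d%:R `^ (- a).
  have na0 : 0 <= - a by rewrite oppr_ge0 ltW.
  have y1 : y `^ (- a)^-1 \in Num.nneg by rewrite nnegrE powR_ge0.
  have d1 : d%:R \in @Num.nneg R by rewrite nnegrE ltW.
  have := ge0_ler_powR na0 y1 d1 yd.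
  by rewrite -powRrM mulVf ?oppr_eq0 ?lt_eqF// powRr1// ltW.
have -> : d%:R `^ a = (d%:R `^ (- a))^-1 by rewrite -powRN opprK.
move=> yda.
rewrite ler_pdivrMr ?powR_gt0//.
apply: (@le_trans _ _ (e * y)); last by rewrite ler_pM2l.
rewrite /y mulrC divfK ?gt_eqF//.
by rewrite (le_trans (ler_norm C))// lerDl.
Unshelve. all: by end_near. Qed.

End asymptotics.

Lemma ATPCA_data_spike (R : realType) (k d N : nat) dO (Omega : measurableType dO)
    (P : probability Omega R) (W : 'I_N * mindex k d -> {RV P >-> R}) (lambda : R)
    (j : mindex k d) (w : Omega) : (0 < d)%N ->
  ATPCA_data lambda W (spike R j) w = fun i => spiked_noise W lambda j i w.
Proof.
move=> d0; apply: funext => i; apply/ffunP => j'.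
rewrite spiked_noiseE [LHS]ffunE [RHS]ffunE spikeE addrC /noise ffunE; congr (_ + _).
by rewrite mulrA mulfK 1?mulrC// gt_eqF// sqrtr_gt0 exprn_gt0// ltr0n.
Qed.

(** The two error terms as powers of x = d, for the cap M just above x ^ eps and
the mesh 1 / n = x ^ (- q). *)
Section one_dimension.
Variables (R : realType) (x eta tau b eps L E C1 C2 C3 lam : R) (d k N T s n M p q : nat).
Hypothesis x_def : x = d%:R.
Hypothesis d_gt0 : (0 < d)%N.
Hypothesis lam_bd : 0 <= lam <= L.
Hypothesis N_le : N%:R <= C1 * x `^ eta.
Hypothesis T_le : T%:R <= C2 * x `^ tau.
Hypothesis s_le : s%:R <= C3 * x `^ b.
Hypothesis eps_gt0 : 0 < eps.
Hypothesis n_def : n = (d ^ q)%N.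
Hypothesis M_def : M = (Num.truncn (x `^ eps)).+1.

Let x1 : 1 <= x. Proof. by rewrite x_def ler1n. Qed.
Let x0 : 0 < x. Proof. exact: lt_le_trans ltr01 x1. Qed.
Let xD (r t : R) : x `^ (r + t) = x `^ r * x `^ t.
Proof. by rewrite powRD//; apply/implyP => _; rewrite gt_eqF. Qed.

Let M_ge : x `^ eps <= M%:R.
Proof. by rewrite M_def; apply: ltW; have /andP[] := truncn_itv (powR_ge0 x eps). Qed.

Let M_le : M%:R <= 2 * x `^ eps.
Proof.
rewrite M_def -natr1; have /andP[h _] := truncn_itv (powR_ge0 x eps).
have : 1 <= x `^ eps by rewrite -(powRr0 x) ler_powR// ltW.
by lra.
Qed.

Lemma samples_lost_mass_le :
  N%:R * lost_mass lam n M <= C1 * x `^ (eta - q%:R) +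
    C1 * expR (p%:R * p.+1%:R * L ^+ 2 / 2) * x `^ (eta - p%:R * eps).
Proof.
have n0 : (0 < n)%N by rewrite n_def expn_gt0 d_gt0.
have M0 : (0 < M)%N by rewrite M_def.
have lm : lost_mass lam n M <=
    x `^ (- q%:R) + expR (p%:R * p.+1%:R * L ^+ 2 / 2) * x `^ (- (p%:R * eps)).
  apply: (le_trans (lost_mass_le lam p n0 M0)); apply: lerD.
    by rewrite powRN (powR_mulrn _ (ltW x0)) n_def natrX x_def.
  apply: ler_pM; [exact: expR_ge0|by rewrite invr_ge0 exprn_ge0| |].
    rewrite ler_expR ler_pM2r ?invr_gt0// ler_wpM2l ?mulr_ge0//.
    by case/andP: lam_bd => l0 lL; rewrite lerXn2r ?nnegrE// (le_trans l0).
  rewrite powRN lef_pV2 ?posrE ?powR_gt0 ?exprn_gt0 ?ltr0n//.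
  by rewrite mulrC powRrM powR_mulrn ?powR_ge0// lerXn2r ?nnegrE ?powR_ge0.
apply: (@le_trans _ _ (C1 * x `^ eta * (x `^ (- q%:R) +
    expR (p%:R * p.+1%:R * L ^+ 2 / 2) * x `^ (- (p%:R * eps))))).
  by apply: ler_pM => //; exact: lost_mass_ge0.
by rewrite !xD; lra.
Qed.

(** The cap enters squared and is at most 2 x ^ eps, whence the loss 2 eps in the
exponent and the constant 64 = 16 * 2 ^ 2. *)
Lemma information_le :
  (N%:R * (16 * M%:R ^+ 2 * (T%:R * (s%:R * ln 2)))) / d%:R ^+ k <=
  (64 * ln 2 * C1 * C2 * C3) * x `^ (eta + tau + b + 2 * eps - k%:R).
Proof.
have l2 : 0 <= ln 2 :> R by rewrite ln_ge0// ler1n.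
rewrite -x_def -(powR_mulrn _ (ltW x0)).
rewrite xD powRN [leRHS]mulrA; apply: ler_wpM2r; first by rewrite invr_ge0 powR_ge0.
have -> : 64 * ln 2 * C1 * C2 * C3 * x `^ (eta + tau + b + 2 * eps) =
    (C1 * x `^ eta) * (16 * (2 * x `^ eps) ^+ 2 * ((C2 * x `^ tau) * ((C3 * x `^ b) * ln 2))).
  by rewrite (_ : 2 * eps = eps + eps) ?xD; ring.
by do ![apply: ler_pM => //]; rewrite ?mulr_ge0.
Qed.

End one_dimension.

Theorem theorem2 (R : realType) (k : nat) (hk : (2 <= k)%N)
  (lambda : nat -> R) (lambda_gt0 : forall d, 0 < lambda d)
  (lambda_asymp : asymp_eq lambda (fun _ => 1))
  (eta tau b : R) (eta_gt0 : 0 < eta) (tau_ge0 : 0 <= tau) (b_ge0 : 0 <= b)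
  (N T s : nat -> nat)
  (N_asymp : asymp_eq (fun d => (N d)%:R) (fun d => d%:R `^ eta / lambda d ^+ 2))
  (T_asymp : asymp_eq (fun d => (T d)%:R) (fun d => d%:R `^ tau))
  (s_asymp : asymp_eq (fun d => (s d)%:R) (fun d => d%:R `^ b))
  (exponents_lt : eta + tau + b < k%:R)
  (disp : nat -> measure_display)
  (Omega : forall d, measurableType (disp d))
  (P : forall d, probability (Omega d) R)
  (W : forall d, 'I_(N d) * mindex k d -> {RV (P d) >-> R})
  (W_iid : forall d, iid_standard_normal (W d))
  (A : forall d, memory_algorithm (tensor R k d) (tensor R k d) (N d) (T d) (s d))
  (t : R) :
  (limn_esup (fun d => ereal_inf
     [set P d [set w | (t ^+ 2 / d%:R ^+ k <=
                        sq_cosine V (memory_output (A d) (ATPCA_data (lambda d) (W d) V w)))%R]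
      | V in @ATPCA_param R k d])
   <= 1 / (t ^+ 2)%:E)%E.
Proof.
have dpow0 (r : R) d : (0 < d)%N -> 0 < d%:R `^ r by move=> d0; rewrite powR_gt0// ltr0n.
have [->|t0] := eqVneq t 0; first by rewrite expr0n/= inve0 mul1e leey.
have t2 : t ^+ 2 != 0 by rewrite expf_neq0.
rewrite div1e inver (negbTE t2); apply/lee_addgt0Pr => e e0; rewrite -EFinD.
have [L L0 lamL] := asymp_le_bound (fun _ _ => ltr01) lambda_asymp.1.
have [L' L'0 lamL'] := asymp_le_bound (fun d _ => lambda_gt0 d) lambda_asymp.2.
have [|CN CN0 NC] := asymp_le_bound _ N_asymp.1.
  by move=> d d0; rewrite divr_gt0 ?dpow0// exprn_gt0.
have [|CT CT0 TC] := asymp_le_bound _ T_asymp.1; first by move=> d; exact: dpow0.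
have [|Cs Cs0 sC] := asymp_le_bound _ s_asymp.1; first by move=> d; exact: dpow0.
(* 2 eps is half of the slack in the hypothesis on the exponents *)
pose eps := (k%:R - (eta + tau + b)) / 4.
have eps0 : 0 < eps by rewrite divr_gt0// subr_gt0.
pose q := (Num.truncn eta).+1.
have qeta : eta - q%:R < 0.
  by rewrite subr_lt0; have /andP[] := truncn_itv (ltW eta_gt0).
pose p := (Num.truncn (eta / eps)).+1.
have peta : eta - p%:R * eps < 0.
  rewrite subr_lt0 -ltr_pdivrMr//.
  by have /andP[] := truncn_itv (divr_ge0 (ltW eta_gt0) (ltW eps0)).
have expo : eta + tau + b + 2 * eps - k%:R < 0 by rewrite /eps; lra.
pose C1 := CN * L' ^+ 2.
have C10 : 0 < C1 by rewrite mulr_gt0// exprn_gt0.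
pose Cp := C1 * expR (p%:R * p.+1%:R * L ^+ 2 / 2).
pose Ce := ((2 * e)^-1 + 8) * (64 * ln 2 * C1 * CT * Cs).
(* the shares of e: e / 2 for kappa = e, 9 * 2 * e / 72 for the lost mass, and
   e / 8 for the information *)
have e72 : 0 < e / 72 by rewrite divr_gt0.
have e8 : 0 < e / 8 by rewrite divr_gt0.
apply: limn_esup_le_near; near=> d.
have d0 : (0 < d)%N by near: d; exact: nbhs_infty_gt.
have lamd : 0 <= lambda d <= L.
  apply/andP; split; first exact: ltW.
  by rewrite -[L]mulr1; near: d.
have lamd' : 1 <= L' * lambda d by near: d.
have Nd : (N d)%:R <= C1 * d%:R `^ eta.
  have : (N d)%:R <= CN * (d%:R `^ eta / lambda d ^+ 2) by near: d.
  move=> /le_trans; apply; rewrite /C1 mulrA mulrAC; apply: ler_wpM2r; first exact: powR_ge0.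
  apply: ler_wpM2l; first exact: ltW.
  rewrite -[leLHS]mul1r ler_pdivrMr ?exprn_gt0// -exprMn.
  by rewrite exprn_ege1.
have Td : (T d)%:R <= CT * d%:R `^ tau by near: d.
have sd : (s d)%:R <= Cs * d%:R `^ b by near: d.
pose n := (d ^ q)%N; pose M := (Num.truncn (d%:R `^ eps : R)).+1.
have n0 : (0 < n)%N by rewrite expn_gt0 d0.
have [j] := exists_spike_le (W_iid d) (A d) (lambda d) d0 n0 (isT : (0 < M)%N) t0 e0.
set err := (X in ((t ^+ 2)^-1 + X)%:E) => Hj.
apply: (@le_trans _ _ ((t ^+ 2)^-1 + err)%:E).
  apply: le_trans Hj; apply: ereal_inf_lbound; exists (spike R j); first exact: spike_param.
  by congr (P d _); apply: funext => w /=; rewrite ATPCA_data_spike.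
rewrite lee_fin lerD2l /err.
have dl0 := lost_mass_ge0 (lambda d) M n0.
have dl1 := lost_mass_le1 (lambda d) n M.
have loss := samples_lost_mass_le p erefl d0 lamd Nd (erefl n) (erefl M).
have info := information_le k erefl d0 Nd Td sd eps0 (erefl M).
have s1 : C1 * d%:R `^ (eta - q%:R) <= e / 72 by near: d; exact: powR_small.
have s2 : Cp * d%:R `^ (eta - p%:R * eps) <= e / 72 by near: d; exact: powR_small.
have s3 : Ce * d%:R `^ (eta + tau + b + 2 * eps - k%:R) <= e / 8.
  by near: d; exact: powR_small.
have sq : (N d)%:R * lost_mass (lambda d) n M ^+ 2 <= (N d)%:R * lost_mass (lambda d) n M.
  by apply: ler_wpM2l => //; rewrite expr2 ler_piMr.
have ce0 : 0 <= (2 * e)^-1 + 8 by rewrite addr_ge0// invr_ge0 mulr_ge0// ltW.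
have third : ((2 * e)^-1 + 8) *
    ((N d)%:R * (16 * M%:R ^+ 2 * ((T d)%:R * ((s d)%:R * ln 2)))) / d%:R ^+ k <= e / 8.
  by rewrite -mulrA; apply: (le_trans (ler_wpM2l ce0 info)); rewrite mulrA.
move: loss s1 s2 third; rewrite -/Cp; lra.
Unshelve. all: by end_near. Qed.
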